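(* Let $k\in\mathbb{Z}$ with $|k|\ge 5$ and let $E=k\cdot \mathrm{Id}\in M_{2\times 2}(\mathbb{Z})$. Then the intersection $[E]\cap\mathcal{U}$ is non-empty, and in fact it contains maps that are real analytically homotopic to $E$.
   Context: $\mathbb{T}^2=\mathbb{R}^2/\mathbb{Z}^2$ and $\mu$ is Lebesgue (Haar) measure on $\mathbb{T}^2$. An integer matrix $E$ with non-zero determinant induces a linear endomorphism $E:\mathbb{T}^2\to\mathbb{T}^2$, denoted by the same letter, and $[E]$ denotes the homotopy class of this map. ''Real analytically homotopic to $E$'' means real analytic and homotopic to $E$ through real analytic maps. Fix a regularity $r\ge 1$. $\mathrm{End}^r_\mu(\mathbb{T}^2)$ is the set of $\mathcal{C}^r$ local diffeomorphisms $f:\mathbb{T}^2\to\mathbb{T}^2$ that preserve $\mu$ (i.e. $\mu(f^{-1}(A))=\mu(A)$ for every Borel set $A$) and are not invertible. $T^1\mathbb{T}^2$ is the unit tangent bundle (for a fixed translation-invariant norm $\|\cdot\|$ on tangent spaces). For $f\in \mathrm{End}^r_\mu(\mathbb{T}^2)$, $(x,v)\in T^1\mathbb{T}^2$ and $n\in\mathbb{N}$, $n\ge 1$, define $$I(x,v;f^n)=\sum_{y\in f^{-n}(x)}\frac{\log\|(D_yf^n)^{-1}v\|}{\det(D_yf^n)},\qquad C_{\mathcal{X}}(f)=\sup_{n\ge 1}\frac1n\inf_{(x,v)\in T^1\mathbb{T}^2} I(x,v;f^n),$$ and $$\mathcal{U}=\{f\in \mathrm{End}^r_\mu(\mathbb{T}^2):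 C_{\mathcal{X}}(f)>0\}.$$ *)

(* Defs.v *)
From HB Require Import structures.
From mathcomp Require Import all_boot all_order all_algebra.
From mathcomp Require Import all_classical all_reals all_analysis.
Set Implicit Arguments.
Unset Strict Implicit.
Unset Printing Implicit Defensive.
Import Order.TTheory GRing.Theory Num.Theory.
Import numFieldNormedType.Exports.
Local Open Scope classical_set_scope.
Local Open Scope ring_scope.
Local Open Scope quotient_scope.

(* Vectors of the plane are rows, so a matrix A acts on them by v |-> v *m A^T,
   and [jacobian], which acts by v |-> v *m 'J F x, is the transpose of the
   usual Jacobian matrix. *)

Definition congZ2 (R : realType) : rel 'rV[R]_2 :=
  fun x y => [forall i, (x - y) 0 i \is a Num.int].

Lemma congZ2_equiv (R : realType) : equiv_class_of (@congZ2 R).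
Proof.
split=> [x | x y | y x z].
- by apply/forallP => i; rewrite subrr mxE rpred0.
- by apply/forallP/forallP => h i; rewrite -opprB mxE rpredN.
- move=> /forallP xy /forallP yz; apply/forallP => i.
  by rewrite -(subrKA y) mxE rpredD.
Qed.

Canonical congZ2_equivRel (R : realType) := EquivRelPack (@congZ2_equiv R).

Definition torus (R : realType) := quotient_topology {eq_quot (@congZ2 R)}.

Definition torus_pi (R : realType) (x : 'rV[R]_2) : torus R := \pi_(torus R) x.

Lemma eq_torus_pi (R : realType) (x y : 'rV[R]_2) :
  torus_pi x = torus_pi y <-> forall i, (x - y) 0 i \is a Num.int.
Proof.
suff E : x = y %[mod {eq_quot (@congZ2 R)}] <-> congZ2 x y.
  by split=> [/E /forallP // | h]; apply/E/forallP.
by split=> [/eqP | h]; [rewrite eqmodE | apply/eqP; rewrite eqmodE].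
Qed.

Definition toral_endo (R : realType) (E : 'M[int]_2) (x : torus R) : torus R :=
  torus_pi (repr x *m (map_mx intr E)^T).

Lemma toral_endo_pi (R : realType) (E : 'M[int]_2) (x : 'rV[R]_2) :
  toral_endo E (torus_pi x) = torus_pi (x *m (map_mx intr E)^T).
Proof.
apply/eq_torus_pi => i; rewrite -mulmxBl mxE; apply: rpred_sum => j _.
apply: rpredM; last by rewrite !mxE intr_int.
by move: j; apply/eq_torus_pi; rewrite /torus_pi reprK.
Qed.

(* The image of planar Lebesgue measure on the fundamental domain [0, 1[^2. *)
Definition haar (R : realType) (A : set (torus R)) : \bar R :=
  (@lebesgue_measure R \x @lebesgue_measure R)%E
    [set p : R * R | `[0, 1[%classic p.1 /\ `[0, 1[%classic p.2 /\
                     A (torus_pi (\row_(i < 2) (if i == 0 then p.1 else p.2)))].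

Definition borel (R : realType) : set_system (torus R) :=
  <<s [set A : set (torus R) | open A] >>.

Definition preserves_haar (R : realType) (f : torus R -> torus R) :=
  forall A, @borel R A -> haar (f @^-1` A) = haar A.

(* Two such F differ, near x, by a constant vector of Z^2. *)
Definition local_lift (R : realType) (f : torus R -> torus R) (x : 'rV[R]_2)
    (F : 'rV[R]_2 -> 'rV[R]_2) :=
  {for x, continuous F} /\ \forall z \near x, torus_pi (F z) = f (torus_pi z).

Definition iter_derive (R : realType) (vs : seq 'rV[R]_2)
    (F : 'rV[R]_2 -> 'rV[R]_2) : 'rV[R]_2 -> 'rV[R]_2 :=
  foldr (fun v G => 'D_v G) F vs.

Definition Cn_on (R : realType) (n : nat) (W : set 'rV[R]_2)
    (F : 'rV[R]_2 -> 'rV[R]_2) :=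
  (forall vs x, (size vs < n)%N -> W x -> differentiable (iter_derive vs F) x) /\
  (forall vs x, (size vs <= n)%N -> W x ->
     {for x, continuous (iter_derive vs F)}).

Definition locally_holder_on (R : realType) (a : R) (W : set 'rV[R]_2)
    (G : 'rV[R]_2 -> 'rV[R]_2) :=
  forall x, W x -> exists C d : R, 0 < d /\
    forall y z, `|y - x| < d -> `|z - x| < d ->
      `|G y - G z| <= C * `|y - z| `^ a.

(* r = +oo gives C^oo; for r = n + a with n a natural number and 0 < a < 1, C^r
   means C^n with locally a-Hoelder derivatives of order n. *)
Definition Cr_on (R : realType) (r : \bar R) (W : set 'rV[R]_2)
    (F : 'rV[R]_2 -> 'rV[R]_2) :=
  (forall n : nat, (n%:R%:E <= r)%E -> Cn_on n W F) /\
  (forall (n : nat) (a : R), r = (n%:R + a)%:E -> 0 < a -> a < 1 ->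
     forall vs, size vs = n -> locally_holder_on a W (iter_derive vs F)).

Definition torus_Cr_on (R : realType) (r : \bar R) (V : set (torus R))
    (f : torus R -> torus R) :=
  forall x, V (torus_pi x) -> exists F, local_lift f x F /\
    exists2 W, open_nbhs x W & Cr_on r W F.

Definition Cr_local_diffeo (R : realType) (r : \bar R)
    (f : torus R -> torus R) :=
  torus_Cr_on r setT f /\
  forall x, exists U : set (torus R), open_nbhs x U /\ open (f @` U) /\
    exists g : torus R -> torus R,
      (forall y, U y -> g (f y) = y) /\ torus_Cr_on r (f @` U) g.

Definition analytic_at (R : realType) (F : 'rV[R]_2 -> 'rV[R]_2)
    (x : 'rV[R]_2) :=
  exists (c : nat -> nat -> 'rV[R]_2) (rho : R), 0 < rho /\
    forall h : 'rV[R]_2, `|h| < rho ->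
      let a i j := (h 0 0 ^+ i * h 0 1 ^+ j) *: c i j in
      cvgn (fun m => \sum_(i < m) \sum_(j < m) `|a i j| : R^o) /\
      (fun m => \sum_(i < m) \sum_(j < m) a i j) @ \oo --> F (x + h).

Definition torus_analytic (R : realType) (f : torus R -> torus R) :=
  forall x, exists F, local_lift f x F /\ analytic_at F x.

Definition is_homotopy (R : realType) (H : R -> torus R -> torus R)
    (f g : torus R -> torus R) :=
  {within `[0, 1]%classic `*` [set: torus R],
     continuous (fun p : R * torus R => H p.1 p.2)} /\ H 0 = f /\ H 1 = g.

Definition homotopy_class (R : realType) (f : torus R -> torus R) :
    set (torus R -> torus R) :=
  [set g | exists H, is_homotopy H f g].

(* Each stage is analytic, while the dependence on t is only continuous. *)
Definition analytically_homotopic (R : realType) (f g : torus R -> torus R) :=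
  exists H, is_homotopy H f g /\
    forall t, 0 <= t -> t <= 1 -> torus_analytic (H t).

(* The choice of the lift and of the representative of y is immaterial. *)
Definition tangent_map (R : realType) (f : torus R -> torus R) (y : torus R) :
    'M[R]_2 :=
  'J (get [set F | local_lift f (repr y) F]) (repr y).

(* A norm on the plane is a translation-invariant norm on the tangent spaces of
   the torus, all identified with the plane; the unit tangent bundle is then the
   set of pairs (x, v) with N v = 1. *)
Definition is_norm (R : realType) (N : 'rV[R]_2 -> R) :=
  (forall v, N v = 0 -> v = 0) /\
  (forall (a : R) v, N (a *: v) = `|a| * N v) /\
  (forall v w, N (v + w) <= N v + N w).

Definition End_haar (R : realType) (r : \bar R) : set (torus R -> torus R) :=
  [set f | Cr_local_diffeo r f /\ preserves_haar f /\ ~ bijective f].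

(* For a local diffeomorphism f the fibre is finite, so the finitely supported
   sum is the full sum. *)
Definition I_sum (R : realType) (N : 'rV[R]_2 -> R) (f : torus R -> torus R)
    (n : nat) (x : torus R) (v : 'rV[R]_2) : R :=
  \sum_(y \in iter n f @^-1` [set x])
    (ln (N (v *m invmx (tangent_map (iter n f) y)))
       / \det (tangent_map (iter n f) y)).

Definition C_X (R : realType) (N : 'rV[R]_2 -> R) (f : torus R -> torus R) :
    \bar R :=
  ereal_sup [set ((n%:R^-1)%:E *
      ereal_inf [set (I_sum N f n p.1 p.2)%:E
                | p in [set p : torus R * 'rV[R]_2 | N p.2 = 1%R]])%E
    | n in [set n : nat | (1 <= n)%N]].

Definition calU (R : realType) (r : \bar R) (N : 'rV[R]_2 -> R) :
    set (torus R -> torus R) :=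
  [set f | End_haar r f /\ (0 < C_X N f)%E].

(* Main.v *)
Require Import Defs.
From mathcomp Require Import all_boot all_order all_algebra.
From mathcomp Require Import all_classical all_reals all_analysis.
From mathcomp Require Import measurable_realfun ring lra zify.
Set Implicit Arguments.
Unset Strict Implicit.
Unset Printing Implicit Defensive.
Import Order.TTheory GRing.Theory Num.Theory.
Import numFieldNormedType.Exports.
Local Open Scope classical_set_scope.
Local Open Scope ring_scope.
Local Open Scope quotient_scope.

(** Put w x = sin (2 pi x) / (2 pi), K = |k|, and let g be the composition of
    two shears of the torus, first (x, y) |-> (x + w y, y) and then
    (x, y) |-> (x, y + b w x). The map is f = k g^-1, for a large real b.

    One iterate is enough. The quantity C_X is a supremum over the iterates, so
    it suffices to bound I (x, v; f) from below for n = 1. The preimages under f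
    of the class of u are the images under g of the K x K points
    u / k + (i / K, j / K), and at the preimage of index (i, j) the inverse
    derivative of f sends v = (v0, v1) to (p_j, q_ij) / k, where
      p_j = v0 + cos (2 pi (y + j / K)) v1,
      q_ij = v1 + b cos (2 pi (x_j + i / K)) p_j,
    for some reals y and x_j. Hence I (x, v; f) is the average over a K x K grid
    of the logarithm of the length of (p_j, q_ij) / k.

    Among K equally spaced angles, at most two make |alpha + beta cos| smaller
    than a fixed proportion of max (|alpha|, |beta|), for whichever alpha and
    beta (few_bad_grid_points). So all but two rows j are good for the first
    shear, and in every row all but two columns i are good for the second one.
    Up to additive constants, log |(p_j, q_ij)| is at least log b if both shears
    are good, 0 if only one is, and - log b if none is
    (shear_pair_lower_bound); that is, (g1 + g2 - 1) log b with g1 and g2 the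
    indicators of goodness. The sum over the grid is then at least
    (2 K (K - 2) - K^2) log b = K (K - 4) log b, which is why K >= 5 is needed.
    A large b beats all constants, including those which compare the norm N with
    the supremum norm (grid_log_average, I_sum_large).

    It remains to see that f is an admissible map. Its lift is built from the
    coordinates with sums, products, sines and cosines, a class of functions
    stable under directional derivatives, so f is smooth, and so is the inverse
    of its lift (descend_local_diffeo). It preserves the Haar measure because it
    is a composition of maps that act on each line of one of the two coordinate
    directions as an affine map m y + c of the circle with m a non-zero integer
    (shear_endo_haar). The lift is a finite sum of products of one-variable
    functions; the only ones that are not elementary power series are the sine
    and cosine of b sin, whose power series are produced by a linear
    differential equation (analytic1_sin_cos). Scaling both shears by t in
    [0, 1] is a homotopy through analytic maps from k Id to f
    (shear_endo_homotopy). *)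

(** * Counting equally spaced angles *)

Lemma finite_pos_lower_bound (R : realType) (I : finType) (u : I -> R) :
  (forall i, 0 < u i) -> exists2 e : R, 0 < e <= 1 & forall i, e <= u i.
Proof.
move=> u0; exists (\big[Order.min/1]_i u i).
  rewrite bigmin_le_id andbT.
  by elim/big_ind : _ => // x y x0 y0; rewrite lt_min x0.
by move=> i; exact: bigmin_le.
Qed.

Lemma cosB_cos (R : realType) (x y : R) :
  cos x - cos y = - (2 * sin ((x + y) / 2) * sin ((x - y) / 2)).
Proof.
have -> : cos x = cos ((x + y) / 2 + (x - y) / 2) by congr cos; lra.
have -> : cos y = cos ((x + y) / 2 - (x - y) / 2) by congr cos; lra.
rewrite cosD cosB; ring.
Qed.

Lemma sin_grid_gt0 (R : realType) (K : nat) : (0 < K)%N ->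
  exists2 e : R, 0 < e <= 1 & forall i j : 'I_K, i != j ->
    e <= `|sin (pi * (i%:R / K%:R - j%:R / K%:R))|.
Proof.
move=> K0; have K0' : 0 < K%:R :> R by rewrite ltr0n.
pose u (p : 'I_K * 'I_K) : R := if p.1 == p.2 then 1 else
  `|sin (pi * (p.1%:R / K%:R - p.2%:R / K%:R))|.
have [|e e0 he] := @finite_pos_lower_bound R _ u; last first.
  exists e => // i j nij; apply: le_trans (he (i, j)) _.
  by rewrite /u /= (negbTE nij).
move=> [i j]; rewrite /u /=; case: ifPn => // nij.
have pos (a b : 'I_K) : (a < b)%N -> 0 < sin (pi * (b%:R / K%:R - a%:R / K%:R) : R).
  move=> ab; apply: sin_gt0_pi; rewrite -mulrBl mulr_gt0 ?pi_gt0 //=; last first.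
    by rewrite divr_gt0 // subr_gt0 ltr_nat.
  rewrite gtr_pMr ?pi_gt0 // ltr_pdivrMr // mul1r.
  have : b%:R < K%:R :> R by rewrite ltr_nat.
  have : 0 <= a%:R :> R by [].
  lra.
move: nij; rewrite -val_eqE neq_ltn => /orP[ij|ji].
  by rewrite -normrN -sinN -mulrN opprB normr_gt0 gt_eqF // pos.
by rewrite normr_gt0 gt_eqF // pos.
Qed.

(** Three distinct angles at which alpha + beta cos is tiny would have nearly
    equal cosines. Since cos x - cos y = -2 sin ((x + y) / 2) sin ((x - y) / 2)
    and the half differences of grid angles have sines bounded away from 0, the
    sines of the half sums of the first angle with each of the other two would
    be tiny, hence so would be the sine of their difference, which is again a
    half difference of grid angles. *)
Lemma few_bad_grid_points (R : realType) (K : nat) : (0 < K)%N ->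
  exists2 c : R, 0 < c < 1 & forall a b y : R,
    (#|[pred j : 'I_K | `|a + b * cos (2 * pi * (y + j%:R / K%:R))|%R
        < c * Num.max `|a| `|b| ]%R| <= 2)%N.
Proof.
move=> K0; have [e /andP[e0 e1] he] := sin_grid_gt0 R K0.
have c0 : 0 < e ^+ 2 / 8 by rewrite divr_gt0 ?exprn_gt0.
have c1 : e ^+ 2 / 8 <= 1/8 by nra.
exists (e ^+ 2 / 8); first by apply/andP; split => //; lra.
move=> a b y; rewrite leqNgt; apply/negP => /card_gt2P.
move=> [i1 [i2 [i3 [[]]]]].
rewrite !inE; set m := Num.max _ _; set c := e ^+ 2 / 8.
move=> h1 h2 h3 [n12 n23 n31].
have m0 : 0 < m.
  by have := le_lt_trans (normr_ge0 _) h1; rewrite pmulr_rgt0.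
(* If |b| were much smaller than |a|, then a + b cos could not be small. *)
have mb : m <= 2 * `|b|.
  have [ab|ba] := leP `|a| `|b|; first by rewrite /m max_r // ler_peMl // ler1n.
  have ma : m = `|a| by rewrite /m max_l // ltW.
  set x := 2 * pi * _ in h1.
  have : `|a| <= `|a + b * cos x| + `|b * cos x|.
    by rewrite -{1}(addrK (b * cos x) a) ler_normB.
  have : `|b * cos x| <= `|b| by rewrite normrM ler_piMr // cos_max.
  have : c * m <= 1/8 * m by rewrite ler_pM2r.
  move: h1; rewrite -ma; lra.
have b0 : 0 < `|b| by lra.
pose th (i : 'I_K) := 2 * pi * (y + i%:R / K%:R).
have key i j : `|a + b * cos (th i)| < c * m -> `|a + b * cos (th j)| < c * m ->
    i != j -> `|sin ((th i + th j) / 2)| < e / 4.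
  move=> hi hj nij.
  have : `|b| * `|cos (th i) - cos (th j)| < `|b| * (e ^+ 2 / 2).
    rewrite -normrM.
    have -> : b * (cos (th i) - cos (th j)) =
      (a + b * cos (th i)) - (a + b * cos (th j)) by ring.
    apply: (le_lt_trans (ler_normB _ _)).
    have : c * m <= c * (2 * `|b|) by rewrite ler_pM2l.
    have -> : `|b| * (e ^+ 2 / 2) = 2 * (c * (2 * `|b|)) by rewrite /c; field.
    lra.
  rewrite ltr_pM2l // cosB_cos normrN !normrM ger0_norm //.
  have -> : (th i - th j) / 2 = pi * (i%:R / K%:R - j%:R / K%:R).
    by rewrite /th; field; rewrite pnatr_eq0 -lt0n.
  have := he _ _ nij; set s2 := `|sin (pi * _)|; set s1 := `|sin _| => es.
  rewrite !ltNge; apply: contraNN => es1.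
  have -> : e ^+ 2 / 2 = 2 * (e / 4) * e by field.
  by apply: ler_pM => //; [lra|exact: ltW|rewrite ler_pM2l].
have k12 := key _ _ h1 h2 n12.
have k13 : `|sin ((th i1 + th i3) / 2)| < e / 4.
  by apply: key => //; rewrite eq_sym.
have := he _ _ n23.
have -> : pi * (i2%:R / K%:R - i3%:R / K%:R) =
    (th i1 + th i2) / 2 - (th i1 + th i3) / 2.
  by rewrite /th; field; rewrite pnatr_eq0 -lt0n.
rewrite sinB.
set A := (th i1 + th i2) / 2 in k12 *; set B := (th i1 + th i3) / 2 in k13 *.
move/le_trans => /(_ _ (ler_normB _ _)).
have : `|sin A * cos B| <= `|sin A| by rewrite normrM ler_piMr // cos_max.
have : `|cos A * sin B| <= `|sin B| by rewrite normrM ler_piMl // cos_max.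
lra.
Qed.

(** * Two shears over a grid *)

Lemma sum_good_grid_points (R : realType) (K : nat) (P : pred 'I_K) :
  (#|[pred j | ~~ P j]| <= 2)%N -> K%:R - 2 <= \sum_(j < K) (P j)%:R :> R.
Proof.
move=> h; have -> : \sum_(j < K) (P j)%:R = #|P|%:R :> R.
  rewrite -sum1_card natr_sum [RHS]big_mkcond /=.
  by apply: eq_bigr => i _; rewrite unfold_in; case: (P i).
have E : (#|P| + #|[pred j | ~~ P j]|)%N = K by rewrite cardC card_ord.
by rewrite -[K in K%:R - 2]E natrD lerBlDr lerD2l (ler_nat _ _ 2).
Qed.

(** If no shear is known to be good, invertibility of the shears still loses at
    most a factor of order t; a single good shear compensates for it, and two
    good shears win a factor of order t. The exponent of t is thus g1 + g2 - 1
    in all four cases. *)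
Lemma shear_pair_lower_bound (R : realType) (c t p q u w : R) (g1 g2 : bool) :
  let m := Num.max `|p| `|q| in
  let p' := p + u * q in let q' := q + t * w * p' in
  0 < c < 1 -> 1 <= t -> 0 < m -> `|u| <= 1 -> `|w| <= 1 ->
  (g1 -> c * m <= `|p'|) -> (g2 -> c * Num.max `|q| `|t * p'| <= `|q'|) ->
  ln (c ^+ 2 * m / 4) + (g1%:R + g2%:R - 1) * ln t <= ln (Num.max `|p'| `|q'|).
Proof.
move=> m p' q' /andP[c0 c1] t1 m0 u1 w1 h1 h2.
have t0 : 0 < t by lra.
set M := Num.max `|p'| `|q'|.
have p'M : `|p'| <= M by rewrite le_max lexx.
have q'M : `|q'| <= M by rewrite le_max lexx orbT.
have mpq : m <= `|p'| + `|q|.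
  rewrite ge_max lerDr normr_ge0 andbT.
  have -> : p = p' - u * q by rewrite /p'; ring.
  apply: (le_trans (ler_normB _ _)); rewrite lerD2l normrM ler_piMl //.
have qpq : `|q| <= `|q'| + t * `|p'|.
  have -> : q = q' - t * w * p' by rewrite /q'; ring.
  apply: (le_trans (ler_normB _ _)); rewrite lerD2l !normrM (gtr0_norm t0).
  by rewrite ler_wpM2r // ler_piMr // ltW.
have c2m : 0 < c ^+ 2 * m by rewrite mulr_gt0 // exprn_gt0.
have c2 : c ^+ 2 <= 1 by rewrite expr_le1 // ltW.
have c2c : c ^+ 2 * m <= c * m by rewrite ler_pM2r // expr2 ler_piMl // ltW.
have cmm : c * m <= m by rewrite ler_piMl // ltW.
have lnt0 : 0 <= ln t by exact: ln_ge0.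
have conv (z : R) : 0 < z -> z <= M -> ln z <= ln M.
  by move=> z0 zM; rewrite ler_ln // posrE // (lt_le_trans z0).
case: g1 h1 h2 => [/(_ isT) h1|_]; case: g2 => [/(_ isT) h2|_] /=.
- have -> : 1%:R + 1%:R - 1 = 1 :> R by ring.
  rewrite mul1r -lnM ?posrE ?divr_gt0 //; apply: conv.
    by rewrite mulr_gt0 // divr_gt0.
  apply: le_trans q'M; apply: le_trans h2.
  have : c * `|t * p'| <= c * Num.max `|q| `|t * p'|.
    by rewrite ler_pM2l // le_max lexx orbT.
  apply: le_trans; rewrite normrM (gtr0_norm t0).
  have : c * (t * (c * m)) <= c * (t * `|p'|) by rewrite !ler_pM2l.
  have : 0 <= c ^+ 2 * m * t by rewrite mulr_ge0 // ltW.
  rewrite expr2; lra.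
- have -> : 1%:R + 0%:R - 1 = 0 :> R by ring.
  rewrite mul0r addr0; apply: conv; first by rewrite divr_gt0.
  lra.
- have -> : 0%:R + 1%:R - 1 = 0 :> R by ring.
  rewrite mul0r addr0; apply: conv; first by rewrite divr_gt0.
  have : c * `|q| <= c * Num.max `|q| `|t * p'|.
    by rewrite ler_pM2l // le_max lexx.
  have : c * `|p'| <= c * Num.max `|q| `|t * p'|.
    rewrite ler_pM2l // le_max; apply/orP; right.
    by rewrite normrM (gtr0_norm t0) ler_peMl.
  have : c * m <= c * (`|p'| + `|q|) by rewrite ler_pM2l.
  lra.
- have -> : 0%:R + 0%:R - 1 = -1 :> R by ring.
  rewrite mulN1r -lnV ?posrE // -lnM ?posrE ?invr_gt0 ?divr_gt0 //.
  apply: conv; first by rewrite !(divr_gt0, mulr_gt0).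
  rewrite ler_pdivrMr //.
  have M0 : 0 <= M by exact: le_trans p'M.
  have : t * `|p'| <= M * t by rewrite mulrC ler_pM2r.
  have : M <= M * t by rewrite ler_peMr.
  lra.
Qed.

(** Summing g1 + g2 - 1 over the grid gives at least K (K - 4) >= 1. The phase
    of the second shear is allowed to depend on the row. *)
Lemma grid_log_average (R : realType) (K : nat) : (5 <= K)%N ->
  exists2 c : R, 0 < c & forall (t p q y : R) (X : 'I_K -> R),
    let p' (j : 'I_K) := p + cos (2 * pi * (y + j%:R / K%:R)) * q in
    let q' (j i : 'I_K) :=
      q + t * cos (2 * pi * (X j + i%:R / K%:R)) * p' j in
    1 <= t -> 0 < Num.max `|p| `|q| ->
    K%:R ^+ 2 * ln (c * Num.max `|p| `|q|) + ln t
      <= \sum_(j < K) \sum_(i < K) ln (Num.max `|p' j| `|q' j i|).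
Proof.
move=> K5; have [|c c01 hc] := @few_bad_grid_points R K; first by case: K K5.
have /andP[c0 c1] := c01.
have c4 : 0 < c ^+ 2 / 4 by rewrite divr_gt0 ?exprn_gt0.
exists (c ^+ 2 / 4) => //.
move=> t p q y X p' q' t1 m0; set m := Num.max _ _ in m0 *.
pose g1 j := c * m <= `|p' j|.
pose g2 j i := c * Num.max `|q| `|t * p' j| <= `|q' j i|.
have lnt0 : 0 <= ln t by exact: ln_ge0.
apply: (@le_trans _ _ (\sum_(j < K) \sum_(i < K)
    (ln (c ^+ 2 * m / 4) + ((g1 j)%:R + (g2 j i)%:R - 1) * ln t))); last first.
  apply: ler_sum => j _; apply: ler_sum => i _.
  by apply: shear_pair_lower_bound => //; exact: cos_max.
have g2K j : K%:R - 2 <= \sum_(i < K) (g2 j i)%:R :> R.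
  apply: sum_good_grid_points.
  apply: leq_trans (hc q (t * p' j) (X j)); apply: subset_leq_card.
  apply/fintype.subsetP => i; rewrite !inE -ltNge; congr (`|_| < _); rewrite /q'; ring.
have g1K : K%:R - 2 <= \sum_(j < K) (g1 j)%:R :> R.
  apply: sum_good_grid_points.
  apply: leq_trans (hc p q y); apply: subset_leq_card.
  apply/fintype.subsetP => i; rewrite !inE -ltNge; congr (`|_| < _); rewrite /p'; ring.
have in_row j : K%:R * ln (c ^+ 2 * m / 4) +
    (K%:R * (g1 j)%:R - 2) * ln t <= \sum_(i < K)
    (ln (c ^+ 2 * m / 4) + ((g1 j)%:R + (g2 j i)%:R - 1) * ln t).
  rewrite big_split /= sumr_const card_ord -[ln _ *+ K]mulr_natl lerD2l.
  rewrite -mulr_suml ler_wpM2r // !big_split /= !sumr_const card_ord.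
  rewrite -[_%:R *+ K]mulr_natl mulNrn.
  have := g2K j; lra.
apply: le_trans (ler_sum _ (fun j _ => in_row j)).
rewrite big_split /= sumr_const card_ord -[(K%:R * _) *+ K]mulr_natl mulrA -expr2.
have -> : c ^+ 2 / 4 * m = c ^+ 2 * m / 4 by ring.
rewrite lerD2l -mulr_suml ler_peMl // big_split /= -mulr_sumr.
rewrite sumr_const card_ord mulNrn -[2 *+ K]mulr_natl.
have K5' : 5 <= K%:R :> R by rewrite (ler_nat _ 5).
have : K%:R * (K%:R - 2) <= K%:R * (\sum_(j < K) (g1 j)%:R) :> R.
  by rewrite ler_pM2l //; lra.
nra.
Qed.

(** * Smooth maps of the plane generated by sines and cosines *)

Definition pt (R : realType) (a b : R) : 'rV[R]_2 :=
  \row_(i < 2) (if i == 0 then a else b).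

Lemma pt0 (R : realType) (a b : R) : pt a b 0 0 = a.
Proof. by rewrite mxE. Qed.

Lemma pt1 (R : realType) (a b : R) : pt a b 0 1 = b.
Proof. by rewrite mxE. Qed.

Definition ptE := (pt0, pt1).

Lemma ord2P (i : 'I_2) : i = 0 \/ i = 1.
Proof. by case: i => [[|[|//]] p]; [left|right]; apply: val_inj. Qed.

Lemma row2P (R : realType) (z w : 'rV[R]_2) :
  z 0 0 = w 0 0 -> z 0 1 = w 0 1 -> z = w.
Proof. by move=> h0 h1; apply/rowP => i; case: (ord2P i) => ->. Qed.

Lemma norm_row2 (R : realType) (z : 'rV[R]_2) :
  `|z| = Num.max `|z 0 0| `|z 0 1|.
Proof.
apply/eqP; rewrite eq_le; apply/andP; split.
  rewrite {1}/Num.Def.normr/= mx_normrE; apply: bigmax_le => [|[i j] _ /=].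
    by rewrite le_max normr_ge0.
  by rewrite ord1 le_max; case: (ord2P j) => ->; rewrite lexx ?orbT.
rewrite /Num.Def.normr/= mx_normrE ge_max; apply/andP; split.
  by apply: (le_bigmax _ _ (0, 0)).
by apply: (le_bigmax _ _ (0, 1)).
Qed.

Lemma norm_coord_le (R : realType) (z : 'rV[R]_2) i : `|z 0 i| <= `|z|.
Proof. by rewrite norm_row2 le_max; case: (ord2P i) => ->; rewrite lexx ?orbT. Qed.

(** An inductive class rather than a regularity statement: stability under
    directional derivatives gives all orders of smoothness at once, by
    induction on the list of directions. *)
Inductive trig_fun (R : realType) : ('rV[R]_2 -> R) -> Prop :=
| trig_cst (c : R) : trig_fun (fun=> c)
| trig_coord i : trig_fun (fun z => z 0 i)
| trigD f g : trig_fun f -> trig_fun g -> trig_fun (fun z => f z + g z)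
| trigM f g : trig_fun f -> trig_fun g -> trig_fun (fun z => f z * g z)
| trig_sin f : trig_fun f -> trig_fun (fun z => sin (f z))
| trig_cos f : trig_fun f -> trig_fun (fun z => cos (f z)).

Lemma is_diff_comp1 (R : realType) (f : 'rV[R]_2 -> R) (g : R -> R) (dg : R) z :
  differentiable f z -> is_derive (f z) 1 g dg ->
  differentiable (fun x => g (f x)) z /\
  forall v, 'D_v (fun x => g (f x)) z = dg * 'D_v f z.
Proof.
move=> df [dgz <-].
have dg' : differentiable g (f z) by apply/derivable1_diffP.
have dgf : differentiable (fun x => g (f x)) z by exact: differentiable_comp.
split=> // v; rewrite !deriveE // diff_comp //= deriv1E //= derive1E.
by rewrite scale1r /GRing.scale /= mulrC.
Qed.

Lemma trig_fun_differentiable (R : realType) (f : 'rV[R]_2 -> R) z :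
  trig_fun f -> differentiable f z.
Proof.
elim=> {f} [c|i|f g _ df _ dg|f g _ df _ dg|f _ df|f _ df].
- exact: differentiable_cst.
- exact: differentiable_coord.
- exact: differentiableD.
- exact: differentiableM.
- exact: (is_diff_comp1 df (is_derive_sin _)).1.
- exact: (is_diff_comp1 df (is_derive_cos _)).1.
Qed.

Lemma derive_coord (R : realType) (i : 'I_2) (z v : 'rV[R]_2) :
  'D_v (fun x : 'rV[R]_2 => x 0 i : R) z = v 0 i.
Proof.
have := derive_mx (@derivable_id _ 'rV[R]_2 z v).
by rewrite derive_id => /matrixP /(_ 0 i) ->; rewrite mxE.
Qed.

Lemma trig_fun_derive (R : realType) (f : 'rV[R]_2 -> R) v :
  trig_fun f -> trig_fun ('D_v f).
Proof.
elim=> {f} [c|i|f g tf IHf tg IHg|f g tf IHf tg IHg|f tf IHf|f tf IHf].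
- have -> : 'D_v (fun=> c) = (fun=> 0) :> ('rV[R]_2 -> R).
    by apply/funext => z; exact: derive_cst.
  exact: trig_cst.
- have -> : 'D_v (fun z : 'rV[R]_2 => z 0 i : R) = (fun=> v 0 i).
    by apply/funext => z; exact: derive_coord.
  exact: trig_cst.
- have -> : 'D_v (fun z => f z + g z) = (fun z => 'D_v f z + 'D_v g z).
    apply/funext => z; apply: deriveD; apply: diff_derivable;
      exact: trig_fun_differentiable.
  exact: trigD.
- have -> : 'D_v (fun z => f z * g z) =
      (fun z => f z * 'D_v g z + g z * 'D_v f z).
    apply/funext => z; apply: deriveM; apply: diff_derivable;
      exact: trig_fun_differentiable.
  by apply: trigD; exact: trigM.
- have -> : 'D_v (fun z => sin (f z)) = (fun z => cos (f z) * 'D_v f z).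
    apply/funext => z; apply: (is_diff_comp1 _ (is_derive_sin _)).2.
    exact: trig_fun_differentiable.
  by apply: trigM => //; exact: trig_cos.
- have -> : 'D_v (fun z => cos (f z)) =
      (fun z => (-1 * sin (f z)) * 'D_v f z).
    apply/funext => z; rewrite mulN1r; apply: (is_diff_comp1 _ (is_derive_cos _)).2.
    exact: trig_fun_differentiable.
  by apply: trigM => //; apply: trigM; [exact: trig_cst|exact: trig_sin].
Qed.

(** The fixed radius 1 avoids minima of radii when such functions are combined.
    *)
Definition locally_lipschitz (R : realType) (f : 'rV[R]_2 -> R) :=
  forall x, exists2 M : R, 0 <= M & forall y z, `|y - x| < 1 -> `|z - x| < 1 ->
    `|f y - f z| <= M * `|y - z|.

Lemma sin_le_id (R : realType) (x : R) : `|sin x| <= `|x|.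
Proof.
suff h (y : R) : 0 <= y -> `|sin y| <= y.
  have [x0|x0] := leP 0 x; first by rewrite (ger0_norm x0) h.
  by rewrite -normrN -sinN (ltr0_norm x0) h // oppr_ge0 ltW.
move=> y0; have [->|yn0] := eqVneq y 0; first by rewrite sin0 normr0.
have {yn0}y0 : 0 < y by rewrite lt_neqAle eq_sym yn0.
have [c _] := @MVT R sin cos 0 y y0 (fun x _ => is_derive_sin x)
  (continuous_subspaceT (@continuous_sin R)).
rewrite sin0 !subr0 => ->; rewrite normrM (gtr0_norm y0) ler_piMl ?cos_max //.
exact: ltW.
Qed.

Lemma sin_lipschitz (R : realType) (x y : R) : `|sin x - sin y| <= `|x - y|.
Proof.
have -> : sin x = sin ((x + y) / 2 + (x - y) / 2) by congr sin; lra.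
have -> : sin y = sin ((x + y) / 2 - (x - y) / 2) by congr sin; lra.
rewrite sinD sinB; set A := (x + y) / 2; set B := (x - y) / 2.
have -> : sin A * cos B + cos A * sin B - (sin A * cos B - cos A * sin B) =
  cos A * (2 * sin B) by ring.
rewrite !normrM (ger0_norm (_ : 0 <= 2)) //.
apply: (@le_trans _ _ (1 * (2 * `|B|))).
  apply: ler_pM => //; [exact: cos_max|by rewrite ler_pM2l // sin_le_id].
by rewrite mul1r /B normrM (ger0_norm (_ : 0 <= 2^-1)) // mulrCA mulfV // mulr1.
Qed.

Lemma cos_lipschitz (R : realType) (x y : R) : `|cos x - cos y| <= `|x - y|.
Proof.
rewrite -!(sinDpihalf) (le_trans (sin_lipschitz _ _)) //.
by rewrite opprD addrACA subrr addr0.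
Qed.

Lemma trig_fun_lipschitz (R : realType) (f : 'rV[R]_2 -> R) :
  trig_fun f -> locally_lipschitz f.
Proof.
elim=> {f} [c|i|f g _ lf _ lg|f g _ lf _ lg|f _ lf|f _ lf] x.
- by exists 0 => // y z _ _; rewrite subrr normr0 mul0r.
- exists 1 => // y z _ _; rewrite mul1r.
  by apply: le_trans (norm_coord_le _ i); rewrite !mxE.
- have [M M0 hM] := lf x; have [L L0 hL] := lg x.
  exists (M + L); first exact: addr_ge0.
  move=> y z yx zx; rewrite opprD addrACA mulrDl.
  by apply: (le_trans (ler_normD _ _)); apply: lerD; [exact: hM|exact: hL].
- have [M M0 hM] := lf x; have [L L0 hL] := lg x.
  have bnd (h : 'rV[R]_2 -> R) (C : R) : 0 <= C ->
      (forall y z, `|y - x| < 1 -> `|z - x| < 1 -> `|h y - h z| <= C * `|y - z|) ->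
      forall y, `|y - x| < 1 -> `|h y| <= `|h x| + C.
    move=> C0 hC y yx; rewrite -lerBlDl.
    apply: (le_trans (lerB_dist _ _)); apply: (le_trans (hC _ _ yx _)).
      by rewrite subrr normr0.
    by rewrite ler_piMr // ltW.
  have bf := bnd _ _ M0 hM; have bg := bnd _ _ L0 hL.
  exists ((`|f x| + M) * L + (`|g x| + L) * M).
    by rewrite addr_ge0 // mulr_ge0 // addr_ge0.
  move=> y z yx zx.
  have -> : f y * g y - f z * g z = f y * (g y - g z) + g z * (f y - f z) by ring.
  apply: (le_trans (ler_normD _ _)); rewrite mulrDl -!mulrA !normrM.
  apply: lerD; apply: ler_pM => //; [exact: bf|exact: hL|exact: bg|exact: hM].
- have [M M0 hM] := lf x; exists M => // y z yx zx.
  exact: le_trans (sin_lipschitz _ _) (hM _ _ yx zx).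
- have [M M0 hM] := lf x; exists M => // y z yx zx.
  exact: le_trans (cos_lipschitz _ _) (hM _ _ yx zx).
Qed.

Definition trig_map (R : realType) (F : 'rV[R]_2 -> 'rV[R]_2) :=
  forall i, trig_fun (fun z => F z 0 i).

Lemma differentiable_rV (R : realType) (F : 'rV[R]_2 -> 'rV[R]_2) z :
  (forall i, differentiable (fun z => F z 0 i : R) z) -> differentiable F z.
Proof.
move=> dF; have -> : F = (fun z => F z 0 0 *: pt 1 0) \+ (fun z => F z 0 1 *: pt 0 1).
  by apply/funext => w; apply: row2P; rewrite !mxE /=; ring.
by apply: differentiableD; apply: differentiableZl.
Qed.

Lemma trig_map_differentiable (R : realType) (F : 'rV[R]_2 -> 'rV[R]_2) z :
  trig_map F -> differentiable F z.
Proof.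
by move=> tF; apply: differentiable_rV => i; exact: trig_fun_differentiable.
Qed.

Lemma derive_rV (R : realType) (F : 'rV[R]_2 -> 'rV[R]_2) z v i :
  differentiable F z -> 'D_v F z 0 i = 'D_v (fun x => F x 0 i) z.
Proof. by move=> dF; rewrite derive_mx ?mxE //; exact: diff_derivable. Qed.

Lemma trig_map_derive (R : realType) (F : 'rV[R]_2 -> 'rV[R]_2) v :
  trig_map F -> trig_map ('D_v F).
Proof.
move=> tF i; have -> : (fun z => 'D_v F z 0 i) = 'D_v (fun x => F x 0 i).
  apply/funext => z; rewrite derive_rV //; exact: trig_map_differentiable.
exact: trig_fun_derive.
Qed.

(** For a non-integer exponent, the derivatives of order n are locally
    Lipschitz, which is stronger than a-Hoelder at distances at most 1. *)
Lemma trig_map_Cr (R : realType) (r : \bar R) (W : set 'rV[R]_2)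
    (F : 'rV[R]_2 -> 'rV[R]_2) : trig_map F -> Cr_on r W F.
Proof.
move=> tF; have tD vs : trig_map (iter_derive vs F).
  by elim: vs => //= v vs; exact: trig_map_derive.
split=> [n _|n a _ a0 a1 vs _ x _].
  split=> vs x _ _; first exact: trig_map_differentiable.
  exact/differentiable_continuous/trig_map_differentiable.
have [M0 M0ge hM0] := trig_fun_lipschitz (tD vs 0) x.
have [M1 M1ge hM1] := trig_fun_lipschitz (tD vs 1) x.
exists (M0 + M1), (1 / 2); split=> // y z yx zx.
have yx1 : `|y - x| < 1 by lra.
have zx1 : `|z - x| < 1 by lra.
have yz : `|y - z| <= `|y - z| `^ a.
  have yz1 : `|y - z| <= 1.
    have -> : y - z = (y - x) - (z - x) by rewrite opprB addrA subrK.
    by apply: (le_trans (ler_normB _ _)); lra.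
  have [->|yz0] := eqVneq `|y - z| 0; first by exact: powR_ge0.
  apply: ger1_powR; last exact: ltW.
  by rewrite yz1 andbT lt_neqAle eq_sym yz0 /=.
apply: (@le_trans _ _ ((M0 + M1) * `|y - z|)).
  rewrite norm_row2 ge_max !mxE mulrDl; apply/andP; split.
    by rewrite (le_trans (hM0 _ _ yx1 zx1)) // lerDl mulr_ge0.
  by rewrite (le_trans (hM1 _ _ yx1 zx1)) // lerDr mulr_ge0.
by rewrite ler_wpM2l // addr_ge0.
Qed.

(** * Maps of the torus given by equivariant lifts *)

Definition int_rV (R : realType) (n : 'rV[R]_2) := forall i, n 0 i \is a Num.int.

Lemma torus_pi_surj (R : realType) (p : torus R) : exists z, torus_pi z = p.
Proof. by exists (repr p); rewrite /torus_pi reprK. Qed.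

Lemma torus_piD (R : realType) (z n : 'rV[R]_2) : int_rV n ->
  torus_pi (z + n) = torus_pi z.
Proof. by move=> hn; apply/eq_torus_pi => i; rewrite addrC addKr. Qed.

Lemma torus_pi_continuous (R : realType) : continuous (@torus_pi R).
Proof. exact: pi_continuous. Qed.

(** The saturation of an open set is the union of its integer translates. *)
Lemma torus_pi_open (R : realType) (A : set 'rV[R]_2) :
  open A -> open (@torus_pi R @` A).
Proof.
move=> oA; rewrite /open /= /quotient_open.
have -> : \pi_(torus R) @^-1` (@torus_pi R @` A) =
    \bigcup_(n in @int_rV R) ((fun z => z - n) @^-1` A).
  apply/seteqP; split => z /=.
    move=> [w Aw wz]; exists (z - w); last by rewrite /= opprB addrC subrK.
    by move=> i; move: i; apply/eq_torus_pi.
  move=> [n hn Azn]; exists (z - n) => //.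
  by rewrite -(@torus_piD _ (z - n) n) // subrK.
apply: bigcup_open => n _; apply: open_comp => // z _.
by apply: continuousB; [exact: id|exact: cst_continuous].
Qed.

Definition Z2_equivariant (R : realType) (F : 'rV[R]_2 -> 'rV[R]_2) :=
  forall z n, int_rV n -> int_rV (F (z + n) - F z).

Definition descend (R : realType) (F : 'rV[R]_2 -> 'rV[R]_2) (p : torus R) :=
  torus_pi (F (repr p)).

Lemma descend_pi (R : realType) (F : 'rV[R]_2 -> 'rV[R]_2) z :
  Z2_equivariant F -> descend F (torus_pi z) = torus_pi (F z).
Proof.
move=> eF; apply/eq_torus_pi.
have h : int_rV (repr (torus_pi z) - z).
  by move=> i; move: i; apply/eq_torus_pi; rewrite /torus_pi reprK.
by have := eF z _ h; rewrite subrKC.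
Qed.

Lemma local_lift_descend (R : realType) (F : 'rV[R]_2 -> 'rV[R]_2) z :
  Z2_equivariant F -> {for z, continuous F} -> local_lift (descend F) z F.
Proof. by move=> eF cF; split=> //; near=> w; rewrite descend_pi.
Unshelve. all: by end_near. Qed.

Lemma int_rV_small (R : realType) (n : 'rV[R]_2) : int_rV n -> `|n| < 1 -> n = 0.
Proof.
move=> hn n1; apply/rowP => i; rewrite mxE; apply/eqP.
have := norm_intr_ge1 (hn i).
case: eqVneq => // _ /(_ isT) h.
by have := le_lt_trans h (le_lt_trans (norm_coord_le _ _) n1); rewrite ltxx.
Qed.

Lemma trig_map_continuous (R : realType) (F : 'rV[R]_2 -> 'rV[R]_2) :
  trig_map F -> continuous F.
Proof.
by move=> tF z; apply/differentiable_continuous/trig_map_differentiable.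
Qed.

Lemma trig_fun_shift (R : realType) (f : 'rV[R]_2 -> R) n :
  trig_fun f -> trig_fun (fun z => f (z - n)).
Proof.
elim=> {f} [c|i|f g _ hf _ hg|f g _ hf _ hg|f _ hf|f _ hf].
- exact: trig_cst.
- have -> : (fun z : 'rV[R]_2 => (z - n) 0 i) = (fun z => z 0 i + - n 0 i).
    by apply/funext => z; rewrite !mxE.
  by apply: trigD; [exact: trig_coord|exact: trig_cst].
- exact: trigD.
- exact: trigM.
- exact: trig_sin.
- exact: trig_cos.
Qed.

Lemma trig_map_shift (R : realType) (F : 'rV[R]_2 -> 'rV[R]_2) n :
  trig_map F -> trig_map (fun z => F (z - n)).
Proof. by move=> tF i; exact: trig_fun_shift (tF i). Qed.

(** The projection is injective on balls of radius 1/2, so the inverse lift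
    restricted to such a ball around F z descends to a local inverse. Around
    another representative x of the same point, a translate of the inverse lift
    is used. *)
Lemma descend_local_diffeo (R : realType) (r : \bar R)
    (F G : 'rV[R]_2 -> 'rV[R]_2) :
  Z2_equivariant F -> trig_map F -> trig_map G -> cancel F G -> cancel G F ->
  Cr_local_diffeo r (descend F).
Proof.
move=> eF tF tG FK GK.
have cF := trig_map_continuous tF; have cG := trig_map_continuous tG.
split.
  move=> z _; exists F; split; first exact: local_lift_descend eF (cF z).
  by exists setT; [split => //; exact: openT|exact: trig_map_Cr].
move=> p; have [z <-] := torus_pi_surj p => {p}.
pose B : set 'rV[R]_2 := ball (F z) (1/2).
have oB : open B by exact: ball_open.
(* Two points of B are at distance less than 1. *)
have B_inj w w' : B w -> B w' -> torus_pi w = torus_pi w' -> w = w'.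
  rewrite /B -ball_normE /= => h h' /eq_torus_pi e; apply/eqP.
  rewrite -subr_eq0; apply/eqP/int_rV_small => //.
  have -> : w - w' = (F z - w') - (F z - w) by rewrite opprB [RHS]addrC addrA subrK.
  by apply: (le_lt_trans (ler_normB _ _)); lra.
have GB : G @` B = F @^-1` B.
  apply/seteqP; split=> w /=; first by move=> [u Bu <-]; rewrite GK.
  by move=> BFw; exists (F w).
have fU : descend F @` (@torus_pi R @` (G @` B)) = @torus_pi R @` B.
  apply/seteqP; split=> p /=.
    move=> [_ [_ [w Bw <-] <-] <-]; exists w => //.
    by rewrite descend_pi // GK.
  move=> [w Bw <-]; exists (torus_pi (G w)); last by rewrite descend_pi // GK.
  by exists (G w) => //; exists w.
exists (@torus_pi R @` (G @` B)); split; [split|split].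
- by apply: torus_pi_open; rewrite GB; apply: open_comp.
- exists z => //; exists (F z) => //; exact: ballxx.
- by rewrite fU; exact: torus_pi_open.
pose g (p : torus R) := torus_pi (G (get [set w | B w /\ torus_pi w = p])).
have gE w : B w -> g (torus_pi w) = torus_pi (G w).
  move=> Bw; rewrite /g; congr (torus_pi (G _)).
  have := @getPex _ [set w' | B w' /\ torus_pi w' = torus_pi w] (ex_intro _ w (conj Bw erefl)).
  by move=> [Bw' /B_inj ->].
exists g; split.
  move=> _ [_ [w Bw <-] <-]; rewrite descend_pi // gE ?GK //.
rewrite fU => x [w Bw wx].
exists (fun y => G (y - (x - w))); split; last first.
  by exists setT; [split => //; exact: openT|apply: trig_map_Cr; exact: trig_map_shift].
split; first exact/trig_map_continuous/trig_map_shift.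
have sub_c : {for x, continuous (fun y : 'rV[R]_2 => y - (x - w))}.
  by apply: continuousB; [exact: id|exact: cst_continuous].
have : \forall y \near x, B (y - (x - w)).
  apply: sub_c; rewrite opprB addrC subrK.
  by apply: open_nbhs_nbhs; split.
apply: filterS => y By; rewrite -gE //; congr g.
apply/eq_torus_pi => i.
have -> : y - (x - w) - y = w - x by rewrite addrC addrA addNr add0r opprB.
by move: i; apply/eq_torus_pi.
Qed.

(** * Power series of the sine and cosine of an analytic function *)

Lemma triangular_sum (R : realType) (F : nat -> nat -> R) n :
  \sum_(0 <= m < n) \sum_(i < m.+1) F i (m - i)%N =
  \sum_(0 <= i < n) \sum_(0 <= j < n - i) F i j.
Proof.
transitivity (\sum_(0 <= m < n) \sum_(0 <= i < n | (i <= m)%N) F i (m - i)%N).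
  apply: eq_big_nat => m mn.
  rewrite -(big_mkord xpredT (fun i => F i (m - i)%N)).
  by rewrite (@big_nat_widen _ _ _ _ m.+1 n).
rewrite (exchange_big_dep_nat xpredT) //=; apply: eq_big_nat => i /= ni.
rewrite -(big_nat_widenl i 0 n xpredT) //.
rewrite -{1}(add0n i) big_addn; apply: eq_bigr => j _; by rewrite addnK.
Qed.

(** The difference between the square and the triangular partial sums is
    dominated, for n >= 2 N, by P n - P N, where P is the sequence of square
    partial sums of the absolute values. *)
Lemma cauchy_product (R : realType) (u v : R ^nat) (U V : R) :
  cvgn (series (fun n => `|u n|)) -> cvgn (series (fun n => `|v n|)) ->
  series u @ \oo --> U -> series v @ \oo --> V ->
  series (fun n => \sum_(i < n.+1) u i * v (n - i)%N) @ \oo --> U * V.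
Proof.
move=> cu cv uU vV.
pose P n := series (fun n => `|u n|) n * series (fun n => `|v n|) n.
pose Ca n := \sum_(0 <= i < n) \sum_(0 <= j < n - i) `|u i| * `|v j|.
have cP : cvgn P by exact: is_cvgM.
have PE n : P n = \sum_(0 <= i < n) \sum_(0 <= j < n) `|u i| * `|v j|.
  rewrite /P /series /= mulr_suml; apply: eq_bigr => i _.
  by rewrite mulr_sumr.
have ndP : nondecreasing_seq P.
  apply/nondecreasing_seqP => n; rewrite /P; apply: ler_pM.
  - by rewrite /series /= sumr_ge0.
  - by rewrite /series /= sumr_ge0.
  - by rewrite /series /= big_nat_recr //= lerDl.
  - by rewrite /series /= big_nat_recr //= lerDl.
(* The square of side N lies inside the triangle of side n once 2 N <= n. *)
have PCa N n : (2 * N <= n)%N -> P N <= Ca n.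
  move=> Nn; have Nn' : (N <= n)%N by lia.
  rewrite PE /Ca (big_cat_nat _ Nn') //= -[X in X <= _]addr0; apply: lerD.
    rewrite big_nat_cond [leRHS]big_nat_cond.
    apply: ler_sum => i /andP[/andP[_ iN] _].
    have Nni : (N <= n - i)%N by lia.
    rewrite (big_cat_nat _ Nni) //= lerDl.
    by apply: sumr_ge0 => j _; rewrite mulr_ge0.
  by apply: sumr_ge0 => i _; apply: sumr_ge0 => j _; rewrite mulr_ge0.
apply: (@cvg_sub0 _ _ _ _ _ _ (series u * series v)) => //; last exact: cvgM.
apply/cvgrPdist_lt => e e0 /=.
have := cP => /cvgrPdist_lt /(_ e e0) [N _ hN].
near=> n; rewrite sub0r normrN.
have Nn : (2 * N <= n)%N by near: n; exact: nbhs_infty_ge.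
apply: le_lt_trans (hN N (leqnn N)) => /=.
rewrite [leRHS]ger0_norm ?subr_ge0 ?nondecreasing_cvgn_le //.
apply: (@le_trans _ _ (P n - Ca n)); last first.
  by apply: lerB; [exact: nondecreasing_cvgn_le|exact: PCa].
rewrite !fctE /series /= (triangular_sum (fun i j => u i * v j)).
rewrite mulr_suml PE /Ca -!sumrB.
apply: (le_trans (ler_norm_sum _ _ _)); apply: ler_sum_nat => i /andP[_ ni].
have nin : (n - i <= n)%N by lia.
rewrite (big_cat_nat _ nin) //= mulrDr -mulr_sumr opprD addrA subrr add0r normrN.
rewrite [X in _ <= X - _](big_cat_nat _ nin) //= addrAC subrr add0r.
by rewrite normrM -mulr_sumr ler_wpM2l // ler_norm_sum.
Unshelve. all: by end_near. Qed.

Definition analytic1 (R : realType) (g : R -> R) (x : R) :=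
  exists a : R ^nat, exists2 rho : R, 0 < rho & forall h, `|h| < rho ->
    cvgn (series (fun i => `|a i * h ^+ i|)) /\
    series (fun i => a i * h ^+ i) @ \oo --> g (x + h).

Lemma series_finite (R : realType) (u : R ^nat) N :
  (forall n, (N <= n)%N -> u n = 0) -> series u @ \oo --> series u N.
Proof.
move=> u0; apply: cvg_near_cst; near=> n.
have Nn : (N <= n)%N by near: n; exact: nbhs_infty_ge.
rewrite /series /= (big_cat_nat _ Nn) //= [X in _ + X]big1_seq ?addr0 //.
by move=> i; rewrite mem_index_iota => /andP[_ /andP[Ni _]]; exact: u0.
Unshelve. all: by end_near. Qed.

Lemma analytic1_affine (R : realType) (c d x : R) : analytic1 (fun y => c + d * y) x.
Proof.
pose a (i : nat) : R := if i == 0 then c + d * x else if i == 1 then d else 0.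
have a0 n : (2 <= n)%N -> a n = 0 by case: n => [|[|]].
exists a, 1 => // h _; split.
  apply/cvg_ex; exists (series (fun i => `|a i * h ^+ i|) 2).
  by apply: series_finite => n n2; rewrite a0 // mul0r normr0.
have -> : c + d * (x + h) = series (fun i => a i * h ^+ i) 2.
  by rewrite /series /= big_mkord !big_ord_recr big_ord0 /= /a /= expr0 expr1; ring.
by apply: series_finite => n n2; rewrite a0 // mul0r.
Qed.

Lemma analytic1Z (R : realType) (g : R -> R) (c x : R) :
  analytic1 g x -> analytic1 (fun y => c * g y) x.
Proof.
move=> [a [rho rho0 ha]]; exists (fun i => c * a i), rho => // h hr.
have [c1 c2] := ha h hr; split.
  have -> : (fun i => `|c * a i * h ^+ i|) = `|c| *: (fun i => `|a i * h ^+ i|).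
    by apply/funext => i; rewrite -mulrA normrM.
  exact: is_cvg_seriesZ.
have -> : series (fun i => c * a i * h ^+ i) = (fun n => c * series (fun i => a i * h ^+ i) n).
  by apply/funext => n; rewrite /series /= mulr_sumr; apply: eq_bigr => i _; rewrite mulrA.
by apply: cvgM => //; exact: cvg_cst.
Qed.

(** The coefficients of a solution of A' = D B, B' = - D A given as power
    series, where D has coefficients d. The n-th coefficients depend on all the
    previous ones, so the list of these is computed, newest first. *)
Fixpoint ode_hist (R : realType) (d : R ^nat) (a0 b0 : R) (n : nat) : seq (R * R) :=
  if n is m.+1 then
    let s := ode_hist d a0 b0 m in
    (m.+1%:R^-1 * \sum_(j < m.+1) d j * (nth (0, 0) s j).2,
     - (m.+1%:R^-1 * \sum_(j < m.+1) d j * (nth (0, 0) s j).1)) :: s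
  else [:: (a0, b0)].

Lemma ode_coefficients (R : realType) (d : R ^nat) (a0 b0 : R) :
  exists a b : R ^nat, [/\ a 0%N = a0, b 0%N = b0,
    forall n, n.+1%:R * a n.+1 = \sum_(j < n.+1) d j * b (n - j)%N &
    forall n, n.+1%:R * b n.+1 = - \sum_(j < n.+1) d j * a (n - j)%N].
Proof.
pose e n := head (0, 0) (ode_hist d a0 b0 n).
have hE n j : (j <= n)%N -> nth (0, 0) (ode_hist d a0 b0 n) j = e (n - j)%N.
  by elim: n j => [|n IH] [|j] //=; exact: IH.
exists (fun n => (e n).1), (fun n => (e n).2); split=> // n.
  rewrite /e /= mulVKf ?pnatr_eq0 //; apply: eq_bigr => j _.
  by rewrite hE // -ltnS.
rewrite /e /= mulrN mulVKf ?pnatr_eq0 //; congr (- _); apply: eq_bigr => j _.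
by rewrite hE // -ltnS.
Qed.

Lemma geometric_bound_cvg (R : realType) (u : R ^nat) (C L z : R) :
  0 < L -> (forall n, `|u n| <= C * L ^+ n) -> L * `|z| < 1 ->
  cvgn (series (fun n => `|u n * z ^+ n|)).
Proof.
move=> L0 uL Lz.
have C0 : 0 <= C by have := le_trans (normr_ge0 _) (uL 0%N); rewrite expr0 mulr1.
apply: (@series_le_cvg _ _ (geometric C (L * `|z|))).
- by move=> n.
- by move=> n; rewrite /geometric /= mulr_ge0 ?exprn_ge0 // mulr_ge0 // ltW.
- move=> n; rewrite /geometric /= normrM normrX exprMn mulrA.
  by rewrite ler_wpM2r // exprn_ge0.
by apply: is_cvg_geometric_series; rewrite ger0_norm // mulr_ge0 // ltW.
Qed.

(** If the sum of |d_j| r^j is at most M0, then L = M0 + 1 / r satisfies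
    L^(n-j) <= L^n r^j, and the recursion multiplies the bound by at most M0.
    *)
Lemma ode_coefficient_bound (R : realType) (d a b : R ^nat) (r M0 : R) :
  0 < r -> (forall n, \sum_(j < n) `|d j * r ^+ j| <= M0) ->
  `|a 0%N| <= 1 -> `|b 0%N| <= 1 ->
  (forall n, n.+1%:R * a n.+1 = \sum_(j < n.+1) d j * b (n - j)%N) ->
  (forall n, n.+1%:R * b n.+1 = - \sum_(j < n.+1) d j * a (n - j)%N) ->
  forall n, `|a n| <= (M0 + r^-1) ^+ n /\ `|b n| <= (M0 + r^-1) ^+ n.
Proof.
move=> r0 dM a0 b0 ha hb; set L := M0 + r^-1.
have M00 : 0 <= M0 by have := dM 0%N; rewrite big_ord0.
have rL : r^-1 <= L by rewrite lerDr.
have L0 : 0 < L by apply: lt_le_trans rL; rewrite invr_gt0.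
have rL1 : 1 <= r * L by rewrite -ler_pdivrMl // mulr1.
have step (c : R ^nat) n : (forall m, (m <= n)%N -> `|c m| <= L ^+ m) ->
    `|\sum_(j < n.+1) d j * c (n - j)%N| <= L ^+ n.+1.
  move=> hc; apply: (le_trans (ler_norm_sum _ _ _)).
  apply: (@le_trans _ _ (\sum_(j < n.+1) `|d j * r ^+ j| * L ^+ n)).
    apply: ler_sum => j _; rewrite !normrM -mulrA ler_wpM2l //.
    apply: (le_trans (hc _ (leq_subr _ _))).
    have jn : (j <= n)%N by rewrite -ltnS.
    have -> : L ^+ n = L ^+ j * L ^+ (n - j) by rewrite -exprD subnKC.
    rewrite mulrA normrX (gtr0_norm r0) -exprMn.
    by rewrite ler_peMl ?exprn_ge0 ?exprn_ege1 // ltW.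
  rewrite -mulr_suml exprS; apply: ler_wpM2r; first by rewrite exprn_ge0 // ltW.
  by apply: (le_trans (dM _)); rewrite lerDl invr_ge0 ltW.
have div n (x : R) y : n.+1%:R * x = y -> `|x| <= `|y|.
  by move=> <-; rewrite normrM normr_nat ler_peMl // ler1n.
elim/ltn_ind => -[_|n IH]; first by rewrite expr0.
split.
  apply: (le_trans (div _ _ _ (ha n))); apply: step => m mn.
  by have [] := IH m mn.
apply: (le_trans (div _ _ _ (hb n))); rewrite normrN; apply: step => m mn.
by have [] := IH m mn.
Qed.

(** The radius 1 / (8 L) leaves room for the factors (n + 1) (n + 2) of the
    second derived series, which are bounded by 2 4^n. *)
Lemma pseries_product_derive (R : realType) (a b d : R ^nat) (L C h : R) :
  0 < L -> (forall n, `|a n| <= L ^+ n) -> (forall n, `|b n| <= L ^+ n) ->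
  cvgn (series (fun i => `|d i * h ^+ i|)) ->
  series (fun i => d i * h ^+ i) @ \oo --> C ->
  (forall n, n.+1%:R * a n.+1 = \sum_(j < n.+1) d j * b (n - j)%N) ->
  `|h| < (8 * L)^-1 ->
  is_derive h 1 (fun x => limn (pseries a x)) (C * limn (pseries b h)).
Proof.
move=> L0 aL bL dcv dC ha hK.
have L8 : 0 < 8 * L by rewrite mulr_gt0.
have K0 : 0 < (8 * L)^-1 by rewrite invr_gt0.
have LK (q : R) : 0 < q -> q <= 4 -> q * L * `|(8 * L)^-1| < 1.
  by move=> q0 q4; rewrite gtr0_norm // ltr_pdivrMr // mul1r ltr_pM2r //; lra.
have cv (u : R ^nat) (M q x : R) : 0 < q -> q <= 4 -> `|x| <= (8 * L)^-1 ->
    (forall n, `|u n| <= M * (q * L) ^+ n) ->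
    cvgn (series (fun i => `|u i * x ^+ i|)).
  move=> q0 q4 xK uM; apply: (geometric_bound_cvg _ uM); first exact: mulr_gt0.
  apply: le_lt_trans (LK q q0 q4); rewrite ler_pM2l ?mulr_gt0 //.
  by rewrite [leRHS]gtr0_norm.
have KK : `|(8 * L)^-1| <= (8 * L)^-1 by rewrite gtr0_norm.
have dE n : pseries_diffs a n = \sum_(j < n.+1) d j * b (n - j)%N.
  exact: ha.
have n2 n : n.+1%:R <= 2 ^+ n :> R.
  by rewrite -natrX ler_nat; exact: ltn_expl.
have db n : `|pseries_diffs a n| <= L * (2 * L) ^+ n.
  rewrite /pseries_diffs normrM normr_nat exprMn mulrCA -exprS.
  by apply: ler_pM.
have ddb n : `|pseries_diffs (pseries_diffs a) n| <= L ^+ 2 * 2 * (4 * L) ^+ n.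
  rewrite /pseries_diffs !normrM !normr_nat.
  have -> : L ^+ 2 * 2 * (4 * L) ^+ n = 2 ^+ n * (2 ^+ n.+1 * L ^+ n.+2).
    have -> : 4 = 2 * 2 :> R by ring.
    by rewrite !exprMn !exprS; ring.
  by apply: ler_pM => //; apply: ler_pM.
have bE : limn (pseries b h) = limn (series (fun i => b i * h ^+ i)) by [].
have cvn (u : R ^nat) : cvgn (series (fun n => `|u n|)) -> cvgn (series u).
  exact: normed_cvg.
have bL1 n : `|b n| <= 1 * (1 * L) ^+ n by rewrite !mul1r.
have aL1 n : `|a n| <= 1 * (1 * L) ^+ n by rewrite !mul1r.
have hK' := ltW hK.
have bcv := cv b 1 1 h ltr01 (ler1n _ 4) hK' bL1.
suff <- : limn (pseries (pseries_diffs a) h) = C * limn (pseries b h).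
  have KE : `|(8 * L)^-1| = (8 * L)^-1 by rewrite gtr0_norm.
  apply: (@pseries_snd_diffs R a (8 * L)^-1 h); rewrite ?KE //.
  - by apply: cvn; apply: (cv a 1 1) => //; exact: (ler1n _ 4).
  - by apply: cvn; apply: (cv _ L 2) => //; lra.
  - by apply: cvn; apply: (cv _ (L ^+ 2 * 2) 4).
apply/cvg_lim => //.
have := cauchy_product dcv bcv dC (cvn _ bcv).
apply: cvg_trans; apply: near_eq_cvg; near=> n.
rewrite /pseries /series /=; apply: eq_bigr => i _; rewrite dE mulr_suml.
apply: eq_bigr => j _; rewrite mulrACA -exprD subnKC //; by rewrite -ltnS.
Unshelve. all: by end_near. Qed.

Lemma zero_derive_eq (R : realType) (Z : R -> R) (rho : R) :
  (forall x : R, `|x| < rho -> is_derive x 1 Z 0) ->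
  forall x : R, `|x| < rho -> Z x = Z 0.
Proof.
move=> dZ.
have main x y : `|x| < rho -> `|y| < rho -> x < y -> Z x = Z y.
  move=> xr yr xy; apply/esym/eqP; rewrite -subr_eq0.
  have sub z : z \in `[x, y]%R -> `|z| < rho.
    rewrite in_itv /= => /andP[xz zy]; move: xr yr; rewrite !ltr_norml.
    by move=> /andP[? ?] /andP[? ?]; apply/andP; split; lra.
  have dZ' (z : R) : z \in `]x, y[%R -> is_derive z 1 Z 0.
    move=> hz; apply: dZ; apply: sub; exact: subset_itv_oo_cc hz.
  have cZ : {within `[x, y], continuous Z}.
    apply: derivable_within_continuous => z zxy.
    by have [] := dZ z (sub _ zxy).
  by have [c _ ->] := MVT xy dZ' cZ; rewrite mul0r.
move=> x xr; have rho0 : 0 < rho by exact: le_lt_trans xr.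
have [x0|x0|->//] := ltrgtP x 0.
  by apply: main => //; rewrite normr0.
by apply/esym/main => //; rewrite normr0.
Qed.

(** The pair (sin psi, cos psi) solves A' = dpsi B, B' = - dpsi A. A power
    series solution exists, and it is the right one because (A - sin psi)^2 +
    (B - cos psi)^2 has zero derivative and vanishes at 0. This replaces the
    composition of power series. *)
Lemma analytic1_sin_cos (R : realType) (psi dpsi : R -> R) (x : R) :
  (forall y : R, is_derive y 1 psi (dpsi y)) -> analytic1 dpsi x ->
  analytic1 (fun y => sin (psi y)) x /\ analytic1 (fun y => cos (psi y)) x.
Proof.
move=> psiD [d [rho rho0 hd]].
have r0 : 0 < rho / 2 by rewrite divr_gt0.
have rr : `|rho / 2| < rho by rewrite gtr0_norm //; lra.
have [dcv _] := hd _ rr.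
pose M0 := limn (series (fun i => `|d i * (rho / 2) ^+ i|)).
have dM n : \sum_(j < n) `|d j * (rho / 2) ^+ j| <= M0.
  rewrite -(big_mkord xpredT (fun j => `|d j * (rho / 2) ^+ j|)).
  apply: (nondecreasing_cvgn_le _ dcv); apply/nondecreasing_seqP => m.
  by rewrite /series /= big_nat_recr //= lerDl.
have [a [b [a0 b0 ha hb]]] := ode_coefficients d (sin (psi x)) (cos (psi x)).
have bound := ode_coefficient_bound r0 dM _ _ ha hb.
rewrite a0 b0 in bound.
have {bound}bound := bound (sin_max _) (cos_max _).
set L := M0 + _ in bound.
have M00 : 0 <= M0 by have := dM 0%N; rewrite big_ord0.
have rL : (rho / 2)^-1 <= L by rewrite lerDr.
have L0 : 0 < L by apply: lt_le_trans rL; rewrite invr_gt0.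
have aL n : `|a n| <= L ^+ n by have [] := bound n.
have bL n : `|b n| <= L ^+ n by have [] := bound n.
have L8 : 0 < (8 * L)^-1 by rewrite invr_gt0 mulr_gt0.
have L8r : (8 * L)^-1 <= rho.
  have : (8 * L)^-1 <= rho / 2.
    rewrite -(invrK (rho / 2)) lef_pV2 ?posrE ?invr_gt0 ?mulr_gt0 //.
    by apply: (le_trans rL); apply: ler_peMl; [exact: ltW|exact: ler1n].
  by move/le_trans; apply; lra.
pose A (h : R) := limn (pseries a h); pose B (h : R) := limn (pseries b h).
have dA (h : R) : `|h| < (8 * L)^-1 -> is_derive h 1 A (dpsi (x + h) * B h).
  move=> hL; have [c1 c2] := hd _ (lt_le_trans hL L8r).
  exact: (pseries_product_derive L0 aL bL c1 c2 ha hL).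
have dB (h : R) : `|h| < (8 * L)^-1 -> is_derive h 1 B (- dpsi (x + h) * A h).
  move=> hL; have [c1 c2] := hd _ (lt_le_trans hL L8r).
  apply: (@pseries_product_derive _ b a (fun i => - d i) L _ h) => //.
  - have -> // : (fun i => `|- d i * h ^+ i|) = (fun i => `|d i * h ^+ i|).
    by apply/funext => i; rewrite mulNr normrN.
  - have -> : series (fun i => - d i * h ^+ i) = - series (fun i => d i * h ^+ i).
      apply/funext => n; rewrite !fctE /series /= -sumrN; apply: eq_bigr => i _.
      by rewrite mulNr.
    exact: cvgN.
  - by move=> n; rewrite hb -sumrN; apply: eq_bigr => j _; rewrite mulNr.
pose psix (h : R) := psi (x + h).
have dpx (h : R) : is_derive h 1 psix (dpsi (x + h)).
  have := @is_derive1_comp _ psi (fun t : R => x + t) h _ _ (psiD (x + h))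
    (is_deriveD (is_derive_cst x h 1) (is_derive_id h 1)).
  by rewrite add0r mulr1.
(* The conserved quantity that forces uniqueness. *)
pose Z (h : R) := (A h - sin (psix h)) ^+ 2 + (B h - cos (psix h)) ^+ 2.
have dZ (h : R) : `|h| < (8 * L)^-1 -> is_derive h 1 Z 0.
  move=> hL; have dAh := dA h hL; have dBh := dB h hL.
  have dS := is_derive1_comp (is_derive_sin (psix h)) (dpx h).
  have dC := is_derive1_comp (is_derive_cos (psix h)) (dpx h).
  have -> : Z = (A - (sin \o psix)) ^+ 2 + (B - (cos \o psix)) ^+ 2.
    by apply/funext => y; rewrite /Z !expr2 !fctE.
  apply: is_derive_eq; rewrite /GRing.scale /= !fctE; ring.
have at0 (u : R ^nat) : limn (pseries u 0) = u 0%N.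
  have -> : u 0%N = series (fun i => u i * 0 ^+ i) 1.
    by rewrite /series /= big_nat1 expr0 mulr1.
  apply/cvg_lim => //; apply: series_finite => n n1.
  by rewrite /= expr0n gtn_eqF // mulr0.
have A0 : A 0 = sin (psi x) by rewrite /A at0.
have B0 : B 0 = cos (psi x) by rewrite /B at0.
have eq0 h : `|h| < (8 * L)^-1 -> A h = sin (psix h) /\ B h = cos (psix h).
  move=> hL; have := zero_derive_eq dZ hL.
  rewrite /Z A0 B0 /psix addr0 !subrr expr0n /= addr0 => /eqP.
  rewrite paddr_eq0 ?sqr_ge0 // !sqrf_eq0 !subr_eq0.
  by move=> /andP[/eqP -> /eqP ->].
have cv (u : R ^nat) h : (forall n, `|u n| <= L ^+ n) -> `|h| < (8 * L)^-1 ->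
    cvgn (series (fun i => `|u i * h ^+ i|)).
  move=> uL hL; apply: (@geometric_bound_cvg _ u 1 L) => //.
    by move=> n; rewrite mul1r.
  rewrite -ltr_pdivlMl // mulr1; apply: (lt_trans hL).
  by rewrite ltf_pV2 ?posrE ?mulr_gt0 // ltr_pMl // ltr1n.
split; [exists a, (8 * L)^-1 => // h hL|exists b, (8 * L)^-1 => // h hL].
  have ca := cv _ _ aL hL; split => //.
  by rewrite -[sin _](eq0 h hL).1; exact: (normed_cvg ca).
have cb := cv _ _ bL hL; split => //.
by rewrite -[cos _](eq0 h hL).2; exact: (normed_cvg cb).
Qed.

(** * The lift of the map and its analyticity *)

(** Square partial sums of a product of one-variable series factor. *)
Lemma analytic_at_mul (R : realType) (f g : R -> R) (u z : 'rV[R]_2) :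
  analytic1 f (z 0 0) -> analytic1 g (z 0 1) ->
  analytic_at (fun w => (f (w 0 0) * g (w 0 1)) *: u) z.
Proof.
move=> [a [ra ra0 ha]] [b [rb rb0 hb]].
exists (fun i j => (a i * b j) *: u), (Num.min ra rb).
rewrite lt_min ra0 rb0; split=> // h; rewrite lt_min => /andP[hra hrb].
have [a1 a2] := ha _ (le_lt_trans (norm_coord_le h 0) hra).
have [b1 b2] := hb _ (le_lt_trans (norm_coord_le h 1) hrb).
split.
  have -> : (fun m => \sum_(i < m) \sum_(j < m)
      `|(h 0 0 ^+ i * h 0 1 ^+ j) *: ((a i * b j) *: u)|) =
    (fun m => series (fun i => `|a i * h 0 0 ^+ i|) m *
      series (fun i => `|b i * h 0 1 ^+ i|) m * `|u|).
    apply/funext => m; rewrite /series /= !big_mkord.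
    rewrite -mulrA mulr_suml; apply: eq_bigr => i _.
    rewrite mulr_suml mulr_sumr; apply: eq_bigr => j _.
    by rewrite scalerA normrZ !normrM; ring.
  by apply: is_cvgM; [exact: is_cvgM|exact: is_cvg_cst].
have -> : (fun m => \sum_(i < m) \sum_(j < m)
    (h 0 0 ^+ i * h 0 1 ^+ j) *: ((a i * b j) *: u)) =
  (fun m => (series (fun i => a i * h 0 0 ^+ i) m *
    series (fun i => b i * h 0 1 ^+ i) m) *: u).
  apply/funext => m; rewrite /series /= !big_mkord.
  rewrite mulr_suml scaler_suml; apply: eq_bigr => i _.
  rewrite mulr_sumr scaler_suml; apply: eq_bigr => j _.
  by rewrite scalerA; congr (_ *: _); ring.
rewrite !mxE; apply: cvgZ; last exact: cvg_cst.
exact: cvgM.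
Qed.

Lemma analytic_atD (R : realType) (F G : 'rV[R]_2 -> 'rV[R]_2) z :
  analytic_at F z -> analytic_at G z -> analytic_at (fun w => F w + G w) z.
Proof.
move=> [c [rc [rc0 hc]]] [d [rd [rd0 hd]]].
exists (fun i j => c i j + d i j), (Num.min rc rd).
rewrite lt_min rc0 rd0; split=> // h; rewrite lt_min => /andP[hrc hrd] e.
have /= [c1 c2] := hc _ hrc; have /= [d1 d2] := hd _ hrd; split; last first.
  have -> : (fun m => \sum_(i < m) \sum_(j < m) e i j) =
    (fun m => \sum_(i < m) \sum_(j < m) (h 0 0 ^+ i * h 0 1 ^+ j) *: c i j) +
    (fun m => \sum_(i < m) \sum_(j < m) (h 0 0 ^+ i * h 0 1 ^+ j) *: d i j).
    apply/funext => m; rewrite !fctE -big_split /=; apply: eq_bigr => i _.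
    by rewrite -big_split /=; apply: eq_bigr => j _; rewrite -scalerDr.
  exact: cvgD.
set C := (fun m => _) in c1; set D := (fun m => _) in d1.
have nd (s : nat -> nat -> R) : (forall i j, 0 <= s i j) ->
    nondecreasing_seq (fun m => \sum_(i < m) \sum_(j < m) s i j : R).
  move=> s0; apply/nondecreasing_seqP => m; rewrite big_ord_recr /=.
  rewrite -[X in X <= _]addr0; apply: lerD; last exact: sumr_ge0.
  by apply: ler_sum => i _; rewrite big_ord_recr /= lerDl.
apply: nondecreasing_is_cvgn; first exact: (nd (fun i j => `|e i j|)).
exists (limn C + limn D) => _ [m _ <-].
apply: (@le_trans _ _ (C m + D m)).
  rewrite -big_split /=; apply: ler_sum => i _.
  rewrite -big_split /=; apply: ler_sum => j _.
  by rewrite /e scalerDr ler_normD.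
have ndC : nondecreasing_seq (C : R ^nat).
  exact: (nd (fun i j => `|(h 0 0 ^+ i * h 0 1 ^+ j) *: c i j|)).
have ndD : nondecreasing_seq (D : R ^nat).
  exact: (nd (fun i j => `|(h 0 0 ^+ i * h 0 1 ^+ j) *: d i j|)).
by apply: lerD; [exact: (nondecreasing_cvgn_le ndC)|exact: (nondecreasing_cvgn_le ndD)].
Qed.

Definition wave (R : realType) (x : R) := sin (2 * pi * x) / (2 * pi).

Lemma twopi_neq0 (R : realType) : 2 * pi != 0 :> R.
Proof. by rewrite mulf_neq0 ?gt_eqF ?pi_gt0. Qed.

Lemma is_derive_affine (R : realType) (c d x : R) :
  is_derive x 1 (fun y => c + d * y) d.
Proof.
have := is_deriveD (is_derive_cst c x 1) (is_deriveZ d (is_derive_id x 1)).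
by rewrite add0r /GRing.scale /= mulr1.
Qed.

Lemma analytic1_ext (R : realType) (f g : R -> R) x :
  f =1 g -> analytic1 f x -> analytic1 g x.
Proof. by move=> /funext ->. Qed.

Lemma analytic1_trig (R : realType) (x : R) :
  analytic1 (fun y => sin (2 * pi * y)) x /\ analytic1 (fun y => cos (2 * pi * y)) x.
Proof.
apply: (@analytic1_sin_cos R (fun y => 2 * pi * y) (fun=> 2 * pi)).
  by move=> y; under eq_fun do rewrite -[2 * pi * _]add0r; exact: is_derive_affine.
apply: (@analytic1_ext R (fun y => 2 * pi + 0 * y)); last exact: analytic1_affine.
by move=> y; rewrite mul0r addr0.
Qed.

Lemma is_derive_wave (R : realType) (x : R) :
  is_derive x 1 (@wave R) (cos (2 * pi * x)).
Proof.
have d : is_derive x 1 (fun y : R => 2 * pi * y) (2 * pi).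
  by under eq_fun do rewrite -[2 * pi * _]add0r; exact: is_derive_affine.
have := is_deriveM (is_derive1_comp (is_derive_sin (2 * pi * x)) d)
  (is_derive_cst ((2 * pi)^-1) x 1).
rewrite scaler0 add0r /GRing.scale /= => h.
apply: is_derive_eq h _; by move: (2 * pi) (@twopi_neq0 R) => p p0; field.
Qed.

Lemma analytic1_trig_wave (R : realType) (b x : R) :
  analytic1 (fun y => sin (2 * pi * (b * wave y))) x /\
  analytic1 (fun y => cos (2 * pi * (b * wave y))) x.
Proof.
apply: (@analytic1_sin_cos R (fun y => 2 * pi * (b * wave y))
  (fun y => 2 * pi * b * cos (2 * pi * y))).
  move=> y; have h := is_deriveZ (2 * pi * b) (is_derive_wave y).
  by under eq_fun do rewrite mulrA.
by apply: analytic1Z; exact: (analytic1_trig x).2.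
Qed.

(** The lift of k g^-1, where g is the shear by a in the first coordinate
    followed by the shear by b in the second one. *)
Definition lift_map (R : realType) (k a b : R) (z : 'rV[R]_2) : 'rV[R]_2 :=
  let y := z 0 1 - b * wave (z 0 0) in pt (k * (z 0 0 - a * wave y)) (k * y).

(** The addition formula for the sine separates the two variables in the
    composed shears. *)
Lemma lift_map_analytic (R : realType) (k a b : R) z :
  analytic_at (lift_map k a b) z.
Proof.
have idA x : analytic1 (@id R) x.
  apply: (@analytic1_ext R (fun y => 0 + 1 * y)); last exact: analytic1_affine.
  by move=> y; rewrite add0r mul1r.
have oneA x : analytic1 (fun=> 1 : R) x.
  apply: (@analytic1_ext R (fun y => 1 + 0 * y)); last exact: analytic1_affine.
  by move=> y; rewrite mul0r addr0.
have -> : lift_map k a b = (fun w =>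
    (w 0 0 * 1) *: pt k 0 + (1 * w 0 1) *: pt 0 k +
    (sin (2 * pi * w 0 0) * 1) *: pt 0 (- (k * b / (2 * pi))) +
    (cos (2 * pi * (b * wave (w 0 0))) * sin (2 * pi * w 0 1))
      *: pt (- (k * a / (2 * pi))) 0 +
    (sin (2 * pi * (b * wave (w 0 0))) * cos (2 * pi * w 0 1))
      *: pt (k * a / (2 * pi)) 0).
  apply/funext => w; apply: row2P; rewrite /lift_map !mxE /=.
    have -> y : wave (w 0 1 - y) = sin (2 * pi * w 0 1 - 2 * pi * y) / (2 * pi).
      by rewrite /wave mulrBr.
    by rewrite sinB; move: (2 * pi) (@twopi_neq0 R) => p p0; field.
  by rewrite /wave; move: (2 * pi) (@twopi_neq0 R) => p p0; field.
have [sA cA] := analytic1_trig (z 0 0).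
have [sA' cA'] := analytic1_trig (z 0 1).
have [swA cwA] := analytic1_trig_wave b (z 0 0).
apply: analytic_atD; [apply: analytic_atD; [apply: analytic_atD; [apply: analytic_atD|]|]|].
- exact: (@analytic_at_mul R id (fun=> 1)).
- exact: (@analytic_at_mul R (fun=> 1) id).
- exact: (@analytic_at_mul R (fun x => sin (2 * pi * x)) (fun=> 1)).
- exact: (@analytic_at_mul R (fun x => cos (2 * pi * (b * wave x)))
    (fun y => sin (2 * pi * y))).
- exact: (@analytic_at_mul R (fun x => sin (2 * pi * (b * wave x)))
    (fun y => cos (2 * pi * y))).
Qed.

(** * Borel sets of the torus *)

(** An open set of the plane is the union of the rational boxes it contains. *)
Lemma open_measurable2 (R : realType) (U : set (R * R)) :
  open U -> measurable (U : set (measurableTypeR R * measurableTypeR R)).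
Proof.
move=> oU.
pose box (q : rat * rat * (rat * rat)) : set (R * R) :=
  `]ratr q.1.1, ratr q.1.2[%classic `*` `]ratr q.2.1, ratr q.2.2[%classic.
pose V q : set (measurableTypeR R * measurableTypeR R) :=
  if `[< box q `<=` U >] then box q else set0.
have -> : U = \bigcup_q V q.
  apply/seteqP; split=> [[x y] Uxy|[x y] [q _]]; last first.
    by rewrite /V; case: asboolP => // h /h.
  have /nbhs_ballP[e /= e0 he] : nbhs (x, y) U by exact: open_nbhs_nbhs.
  have rat_near (z : R) : exists q : rat * rat,
      [/\ z - e < ratr q.1, ratr q.1 < z, z < ratr q.2 & ratr q.2 < z + e].
    have [|q1] := @rat_in_itvoo R (z - e) z; first by lra.
    rewrite in_itv /= => /andP[h1 h2].
    have [|q2] := @rat_in_itvoo R z (z + e); first by lra.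
    by rewrite in_itv /= => /andP[h3 h4]; exists (q1, q2).
  have [q [q1 q2 q3 q4]] := rat_near x; have [s [s1 s2 s3 s4]] := rat_near y.
  exists (q, s) => //; rewrite /V; case: asboolP => [_|].
    by split; rewrite /= in_itv /=; apply/andP.
  case=> -[u v] [] /=; rewrite !in_itv /= => /andP[u1 u2] /andP[v1 v2].
  by apply: he; split; rewrite /ball /= ltr_norml; apply/andP; split; lra.
apply: countable_bigcupT_measurable => [|q]; first exact: countableP.
rewrite /V; case: ifP => _.
  by apply: measurableX; exact: measurable_itv.
exact: measurable0.
Qed.

(** Only preimages of open sets need to be checked, as the sets with a
    measurable preimage form a sigma-algebra. *)
Lemma borel_preimage (R : realType) d (T : measurableType d) (g : T -> torus R)
    (A : set (torus R)) :
  (forall O, open O -> measurable (g @^-1` O)) ->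
  borel A -> measurable (g @^-1` A).
Proof.
move=> gO; move: A; apply: smallest_sub => [|A oA]; last exact: gO.
split=> [|A mA|F mF].
- by rewrite preimage_set0; exact: measurable0.
- by rewrite setTD preimage_setC; exact: measurableC.
- by rewrite preimage_bigcup; exact: bigcupT_measurable.
Qed.

Lemma borel_continuous_preimage (R : realType) (f : torus R -> torus R) A :
  continuous f -> borel A -> borel (f @^-1` A).
Proof.
move=> cf; move: A; apply: smallest_sub => [|A oA]; last first.
  by apply: sub_sigma_algebra; apply: open_comp => // x _; exact: cf.
split=> [|A mA|F mF].
- by rewrite preimage_set0; exact: sigma_algebra0.
- rewrite setTD preimage_setC -setTD; exact: sigma_algebraCD.
- by rewrite preimage_bigcup; exact: sigma_algebra_bigcup.
Qed.

(** * Affine maps of the circle preserve the Lebesgue measure *)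

(** Uniqueness of the Lebesgue measure, applied to the image of the Lebesgue
    measure rescaled by |m|. *)
Lemma lebesgue_measure_affine (R : realType) (m c : R) (S : set R) :
  m != 0 -> measurable S ->
  lebesgue_measure ((fun y : R => m * y + c) @^-1` S) =
  (`|m|^-1%:E * lebesgue_measure S)%E.
Proof.
move=> m0 mS; pose g (y : measurableTypeR R) : measurableTypeR R := m * y + c.
have mg : measurable_fun setT g.
  by apply: measurable_funD => //; exact: measurable_funM.
have pm0 : 0 <= `|m| by [].
pose mu' := (mscale (NngNum pm0) (pushforward lebesgue_measure g) :
  {measure set (measurableTypeR R) -> \bar R}).
pose mu := mu' mg.
have muE X : mu X = (`|m|%:E * lebesgue_measure (g @^-1` X))%E by [].
suff <- : mu S = lebesgue_measure S.
  by rewrite muE muleA -EFinM mulVf ?normr_eq0 // mul1e.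
apply/esym; move: S mS; apply: lebesgue_measure_unique => _ [[a b] _ <-].
rewrite muE /= lebesgue_measure_itv /= lte_fin.
have E0 : `|m| * ((b - c) / m) - `|m| * ((a - c) / m) = (b - a) * (`|m| / m).
  by field.
have [mp|mn] : 0 < m \/ m < 0 by move: m0; rewrite neq_lt => /orP[]; [right|left].
  have -> : g @^-1` `]a, b]%classic = `](a - c) / m, (b - c) / m]%classic.
    apply/seteqP; split=> y; rewrite /g /= !in_itv /= ltr_pdivrMr // ler_pdivlMr //;
      by rewrite ltrBlDr lerBrDr mulrC.
  rewrite lebesgue_measure_itv /= lte_fin ltr_pM2r ?invr_gt0 // ltrD2r.
  case: ifPn => // ab; last by rewrite mule0.
  rewrite -!EFinB -EFinM mulrBr E0 gtr0_norm // mulfV ?mulr1 //.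
have -> : g @^-1` `]a, b]%classic = `[(b - c) / m, (a - c) / m[%classic.
  apply/seteqP; split=> y; rewrite /g /= !in_itv /= ltr_ndivlMr // ler_ndivrMr //;
    by rewrite ltrBlDr lerBrDr mulrC andbC.
rewrite lebesgue_measure_itv /= lte_fin ltr_nM2r ?invr_lt0 // ltrD2r.
case: ifPn => // ab; last by rewrite mule0.
rewrite -!EFinB -EFinM; congr EFin.
have -> : `|m| * ((a - c) / m - (b - c) / m) = (a - b) * (`|m| / m) by field.
by rewrite ltr0_norm // mulNr mulfV // mulrN1 opprB.
Qed.

Definition periodic1 (R : realType) (B : set R) :=
  forall y n, n \is a Num.int -> B (y + n) = B y.

Lemma measurable_itv_cap (R : realType) (B : set R) (i : interval R) :
  measurable B -> measurable (B `&` [set` i]).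
Proof. by move=> mB; apply: measurableI => //; exact: measurable_itv. Qed.

Lemma periodic_translate (R : realType) (B : set R) (u v n : R) :
  measurable B -> periodic1 B -> n \is a Num.int ->
  lebesgue_measure (B `&` `[u + n, v + n[%classic) = lebesgue_measure (B `&` `[u, v[%classic).
Proof.
move=> mB pB hn.
have := @lebesgue_measure_affine R 1 n _ (oner_neq0 _)
  (measurable_itv_cap `[u + n, v + n[ mB).
rewrite normr1 invr1 mul1e => <-; congr (lebesgue_measure _).
by apply/seteqP; split=> y; rewrite /= mul1r !in_itv /= lerD2r ltrD2r pB.
Qed.

Lemma lebesgue_measure_split (R : realType) (B : set R) (u v w : R) :
  measurable B -> u <= v -> v <= w ->
  lebesgue_measure (B `&` `[u, w[%classic) =
  (lebesgue_measure (B `&` `[u, v[%classic) + lebesgue_measure (B `&` `[v, w[%classic))%E.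
Proof.
move=> mB uv vw; rewrite -measureU; first last.
- rewrite -setIACA setIid; apply/seteqP; split=> y //= -[_].
  by rewrite !in_itv /= => -[/andP[_ h1] /andP[/(lt_le_trans h1)]]; rewrite ltxx.
- exact: measurable_itv_cap.
- exact: measurable_itv_cap.
rewrite -setIUr; congr (lebesgue_measure (_ `&` _)).
apply/seteqP; split=> y; rewrite /= !in_itv /=.
  by move=> /andP[uy yw]; have [yv|vy] := ltP y v; [left; rewrite uy|right].
by move=> [] /andP[h1 h2]; apply/andP; split=> //; lra.
Qed.

Lemma periodic_unit_interval (R : realType) (B : set R) (c : R) :
  measurable B -> periodic1 B ->
  lebesgue_measure (B `&` `[c, c + 1[%classic) = lebesgue_measure (B `&` `[0, 1[%classic).
Proof.
move=> mB pB; pose N : R := (Num.floor c)%:~R.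
have Ni : N \is a Num.int by exact: intr_int.
have Nc : N <= c by exact: floor_le_tmp.
have cN : c <= N + 1 by apply: ltW; rewrite -intrD1; exact: floorD1_gt.
rewrite (lebesgue_measure_split mB cN) ?lerD2r //.
rewrite (periodic_translate _ _ mB pB) ?rpred1 // addeC.
rewrite -lebesgue_measure_split //.
have := periodic_translate 0 1 mB pB Ni.
by rewrite add0r addrC.
Qed.

Lemma periodic_long_interval (R : realType) (B : set R) (c : R) (n : nat) :
  measurable B -> periodic1 B ->
  lebesgue_measure (B `&` `[c, c + n%:R[%classic) =
  (n%:R%:E * lebesgue_measure (B `&` `[0%R, 1%R[%classic))%E.
Proof.
move=> mB pB; elim: n => [|n IH].
  by rewrite mul0e addr0 set_itvxx setI0 measure0.
have h1 : c <= c + n%:R by rewrite lerDl.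
have h2 : c + n%:R <= c + n.+1%:R by rewrite lerD2l ler_nat.
rewrite (lebesgue_measure_split mB h1 h2) IH.
have -> : c + n.+1%:R = (c + n%:R) + 1 by rewrite -addrA natr1.
rewrite periodic_unit_interval // -natr1 EFinD ge0_muleDl ?lee_fin //.
by rewrite mul1e.
Qed.

(** For m > 0 the affine map sends [0, 1[ onto an interval of length m, on
    which a 1-periodic set has m times its measure per period. For m < 0 one
    first reflects [0, 1[ into ]0, 1], which agrees with it up to a null set.
    *)
Lemma periodic_affine (R : realType) (B : set R) (m : int) (c : R) :
  m != 0 -> measurable B -> periodic1 B ->
  lebesgue_measure [set y : R | `[0, 1[%classic y /\ B (m%:~R * y + c)] =
  lebesgue_measure (B `&` `[0, 1[%classic).
Proof.
move=> m0 mB pB.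
have pos (n : nat) c' : (0 < n)%N ->
    lebesgue_measure [set y : R | `[0, 1[%classic y /\ B (n%:R * y + c')] =
    lebesgue_measure (B `&` `[0, 1[%classic).
  move=> n0; have n0' : n%:R != 0 :> R by rewrite pnatr_eq0 -lt0n.
  have := @lebesgue_measure_affine R n%:R c' _ n0'
    (measurable_itv_cap `[c', c' + n%:R[ mB).
  rewrite periodic_long_interval // muleA -EFinM normr_nat mulVf // mul1e => <-.
  congr (lebesgue_measure _); apply/seteqP; split=> y; rewrite /= !in_itv /=.
    move=> [/andP[y0 y1] By]; split=> //; rewrite addrC lerDl ltrD2l mulr_ge0 //.
    by rewrite gtr_pMr // ltr0n.
  rewrite [_ + c']addrC lerDl ltrD2l => -[By /andP[y0 y1]]; split=> //.
  by rewrite -(pmulr_rge0 _ (_ : 0 < n%:R)) ?ltr0n // y0 -(gtr_pMr _ (_ : 0 < n%:R)) ?ltr0n.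
case: m m0 => [n|n] n0; first by rewrite -(pos n c) // lt0n.
rewrite -(pos n.+1 (c - n.+1%:R)) //.
pose P := [set y : R | B (n.+1%:R * y + (c - n.+1%:R))].
have mP : measurable P.
  have mg : measurable_fun [set: measurableTypeR R]
      (fun y : measurableTypeR R => n.+1%:R * y + (c - n.+1%:R) : measurableTypeR R).
    by apply: measurable_funD => //; exact: measurable_funM.
  by have := mg measurableT B mB; rewrite setTI.
have P01 : P 0 = P 1.
  rewrite /P /= mulr0 mulr1 add0r.
  have -> : n.+1%:R + (c - n.+1%:R) = c - n.+1%:R + n.+1%:R by ring.
  by rewrite [RHS]pB // rpred_nat.
have null (a : R) : lebesgue_measure (P `&` [set a]) = 0%E.
  apply/eqP; rewrite -measure_le0 -(lebesgue_measure_set1 a).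
  by apply: le_measure; rewrite ?inE; [exact: measurableI|exact: measurable_set1|exact: subIsetr].
have m01 := measurable_itv_cap `]0, 1[ mP.
have mset1 (a : R) : measurable (P `&` [set a]) by exact: measurableI.
transitivity (lebesgue_measure (P `&` `]0, 1]%classic)).
  have m1 : (-1 : R) != 0 by rewrite oppr_eq0 oner_neq0.
  have mP' : measurable (P `&` `]0, 1]%classic) by exact: measurable_itv_cap.
  have := @lebesgue_measure_affine R (-1) 1 _ m1 mP'.
  rewrite normrN1 invr1 mul1e => <-.
  congr (lebesgue_measure _); apply/seteqP; split=> y; rewrite /P /= !in_itv /= NegzE.
    move=> [/andP[y0 y1] By]; split; last by apply/andP; split; lra.
    by move: By; congr B; rewrite rmorphN /=; ring.
  move=> [By /andP[y0 y1]]; split; first by apply/andP; split; lra.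
  by move: By; congr B; rewrite rmorphN /=; ring.
transitivity (lebesgue_measure (P `&` `]0, 1[%classic)).
  rewrite -(@measureU0 _ _ _ lebesgue_measure _ _ m01 (mset1 1) (null 1)) -setIUr.
  congr (lebesgue_measure (_ `&` _)).
  apply/seteqP; split=> y; rewrite /= !in_itv /=.
    move=> /andP[y0]; rewrite le_eqVlt => /orP[/eqP ->|y1]; [by right|left].
    by rewrite y0.
  by move=> [/andP[y0 y1]|->]; apply/andP; split => //; exact: ltW.
rewrite -(@measureU0 _ _ _ lebesgue_measure _ _ m01 (mset1 0) (null 0)) -setIUr [LHS]/=.
congr (lebesgue_measure _).
apply/seteqP; split=> y; rewrite /P /= !in_itv /=.
  by move=> [By [/andP[y0 y1]|y0]]; split => //; apply/andP; split; lra.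
move=> [/andP[]]; rewrite le_eqVlt => /orP[/eqP <-|y0] y1 By; split => //.
  by right.
by left; rewrite y0.
Qed.

(** * The map preserves the Haar measure *)

Lemma periodic_intmul (R : realType) (f : R -> R) (T x n : R) :
  periodic f T -> n \is a Num.int -> f (x + T * n) = f x.
Proof.
move=> fT /intrP[[m|m] ->].
  by rewrite -[in LHS]pmulrn mulr_natr periodicn.
by rewrite NegzE rmorphN mulrN /= -[in LHS](periodicn fT m.+1) -mulr_natr subrK.
Qed.

Lemma wave_int (R : realType) (x n : R) : n \is a Num.int -> wave (x + n) = wave x.
Proof.
move=> hn; rewrite /wave mulrDr; congr (_ / _).
rewrite [2 * pi]mulr_natl; apply: periodic_intmul => //; exact: sinD2pi.
Qed.

Lemma int_rV_pt (R : realType) (a b : R) :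
  a \is a Num.int -> b \is a Num.int -> int_rV (pt a b).
Proof. by move=> ha hb i; case: (ord2P i) => ->; rewrite ptE. Qed.

Lemma pt_sub (R : realType) (a b c d : R) : pt a b - pt c d = pt (a - c) (b - d).
Proof. by apply: row2P; rewrite !mxE. Qed.

Definition vertical_map (R : realType) (m : int) (c : R) (z : 'rV[R]_2) :=
  pt (z 0 0) (m%:~R * z 0 1 + c * wave (z 0 0)).

Definition horizontal_map (R : realType) (m : int) (c : R) (z : 'rV[R]_2) :=
  pt (m%:~R * z 0 0 + c * wave (z 0 1)) (z 0 1).

Lemma vertical_equivariant (R : realType) (m : int) (c : R) :
  Z2_equivariant (@vertical_map R m c).
Proof.
move=> z n hn; rewrite /vertical_map pt_sub !mxE wave_int //.
apply: int_rV_pt; first by have -> : z 0 0 + n 0 0 - z 0 0 = n 0 0 by ring.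
have -> : m%:~R * (z 0 1 + n 0 1) + c * wave (z 0 0) -
  (m%:~R * z 0 1 + c * wave (z 0 0)) = m%:~R * n 0 1 by ring.
by apply: rpredM => //; exact: intr_int.
Qed.

Lemma horizontal_equivariant (R : realType) (m : int) (c : R) :
  Z2_equivariant (@horizontal_map R m c).
Proof.
move=> z n hn; rewrite /horizontal_map pt_sub !mxE wave_int //.
apply: int_rV_pt; last by have -> : z 0 1 + n 0 1 - z 0 1 = n 0 1 by ring.
have -> : m%:~R * (z 0 0 + n 0 0) + c * wave (z 0 1) -
  (m%:~R * z 0 0 + c * wave (z 0 1)) = m%:~R * n 0 0 by ring.
by apply: rpredM => //; exact: intr_int.
Qed.

Lemma trig_fun_wave (R : realType) (f : 'rV[R]_2 -> R) :
  trig_fun f -> trig_fun (fun z => wave (f z)).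
Proof.
move=> tf; apply: trigM; last exact: trig_cst.
by apply: trig_sin; apply: trigM => //; exact: trig_cst.
Qed.

Lemma trig_map_pt (R : realType) (f g : 'rV[R]_2 -> R) :
  trig_fun f -> trig_fun g -> trig_map (fun z => pt (f z) (g z)).
Proof.
move=> tf tg i; case: (ord2P i) => ->.
  by have -> : (fun z => pt (f z) (g z) 0 0) = f by apply/funext => z; rewrite pt0.
by have -> : (fun z => pt (f z) (g z) 0 1) = g by apply/funext => z; rewrite pt1.
Qed.

Lemma vertical_trig (R : realType) (m : int) (c : R) : trig_map (@vertical_map R m c).
Proof.
apply: trig_map_pt; first exact: trig_coord.
by apply: trigD; apply: trigM; try exact: trig_cst;
  [exact: trig_coord|apply: trig_fun_wave; exact: trig_coord].
Qed.

Lemma horizontal_trig (R : realType) (m : int) (c : R) :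
  trig_map (@horizontal_map R m c).
Proof.
apply: trig_map_pt; last exact: trig_coord.
by apply: trigD; apply: trigM; try exact: trig_cst;
  [exact: trig_coord|apply: trig_fun_wave; exact: trig_coord].
Qed.

Lemma descend_continuous (R : realType) (F : 'rV[R]_2 -> 'rV[R]_2) :
  Z2_equivariant F -> continuous F -> continuous (descend F).
Proof.
move=> eF cF; apply/quotient_continuous.
have -> : descend F \o \pi_(torus R) = @torus_pi R \o F.
  by apply/funext => z; exact: descend_pi.
by move=> z; apply: continuous_comp; [exact: cF|exact: torus_pi_continuous].
Qed.

Definition chart (R : realType) (p : R * R) : torus R := torus_pi (pt p.1 p.2).

Lemma pt_continuous (R : realType) : continuous (fun p : R * R => pt p.1 p.2).
Proof.
move=> p; have -> : (fun p : R * R => pt p.1 p.2) =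
    (fun p => p.1 *: pt 1 0 + p.2 *: pt 0 1).
  by apply/funext => q; apply: row2P; rewrite !mxE /=; ring.
by apply: cvgD; (apply: cvgZ; last exact: cvg_cst); [exact: cvg_fst|exact: cvg_snd].
Qed.

Lemma chart_continuous (R : realType) : continuous (@chart R).
Proof.
by move=> p; apply: continuous_comp; [exact: pt_continuous|exact: torus_pi_continuous].
Qed.

Definition unit_square_part (R : realType) (A : set (torus R)) :
    set (measurableTypeR R * measurableTypeR R) :=
  (`[0, 1[%classic `*` `[0, 1[%classic) `&` @chart R @^-1` A.

Lemma haarE (R : realType) (A : set (torus R)) :
  haar A = (@lebesgue_measure R \x @lebesgue_measure R)%E (unit_square_part A).
Proof.
rewrite /haar; congr (_ _); apply/seteqP; split=> p /=.
  by move=> [? [? ?]].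
by move=> [[? ?] ?].
Qed.

Lemma unit_square_part_measurable (R : realType) (A : set (torus R)) :
  borel A -> measurable (unit_square_part A).
Proof.
move=> bA; apply: measurableI; first by apply: measurableX; exact: measurable_itv.
apply: (borel_preimage _ bA) => O oO; apply: open_measurable2.
by apply: open_comp => // p _; exact: chart_continuous.
Qed.

(** The Haar measure is defined by slices in one direction; slices in the other
    direction compute it as well, but for Borel sets only. *)
Lemma haar_swap (R : realType) (A : set (torus R)) : borel A ->
  haar A = (@lebesgue_measure R \x^ @lebesgue_measure R)%E (unit_square_part A).
Proof.
move=> bA; rewrite haarE.
apply: (product_measure_unique (m' := (@lebesgue_measure R \x^ @lebesgue_measure R)%E)).
  by move=> X Y mX mY; exact: product_measure2E.
exact: unit_square_part_measurable.
Qed.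

Lemma borel_line (R : realType) (A : set (torus R)) (g : R -> R * R) :
  borel A -> continuous g -> measurable (g @^-1` (@chart R @^-1` A)).
Proof.
move=> bA cg; rewrite -comp_preimage.
apply: (@borel_preimage R _ (measurableTypeR R)) bA => O oO.
apply: open_measurable; apply: open_comp => // y _.
by apply: continuous_comp; [exact: cg|exact: chart_continuous].
Qed.

Lemma borel_sections (R : realType) (A : set (torus R)) (a : R) : borel A ->
  measurable [set y : R | A (chart (a, y))] /\
  measurable [set x : R | A (chart (x, a))].
Proof.
move=> bA; split.
  apply: (@borel_line R A (fun y : R => (a, y)) bA) => y.
  apply: (@cvg_pair R R R (nbhs y) (nbhs a) (nbhs y) _ _ _ (fun=> a) id).
    exact: cvg_cst.
  exact: cvg_id.
apply: (@borel_line R A (fun x : R => (x, a)) bA) => x.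
apply: (@cvg_pair R R R (nbhs x) (nbhs x) (nbhs a) _ _ _ id (fun=> a)).
  exact: cvg_id.
exact: cvg_cst.
Qed.

(** Slice by slice, this is the invariance of the Lebesgue measure under affine
    maps of the circle. *)
Lemma vertical_haar (R : realType) (m : int) (c : R) (A : set (torus R)) :
  m != 0 -> borel A -> haar (descend (@vertical_map R m c) @^-1` A) = haar A.
Proof.
move=> m0 bA; rewrite !haarE; apply: eq_integral => x _ /=.
pose B := [set y : R | A (chart (x, y))].
have mB : measurable B := (borel_sections x bA).1.
have pB : periodic1 B.
  move=> y n hn; rewrite /B /=; congr A; rewrite /chart /=.
  have -> : pt x (y + n) = pt x y + pt 0 n by apply: row2P; rewrite !mxE /= ?addr0.
  by apply: torus_piD; apply: int_rV_pt => //; exact: rpred0.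
have sE (D : set (torus R)) : xsection (unit_square_part D) x =
    [set y | `[0, 1[%classic x /\ `[0, 1[%classic y /\ D (chart (x, y))].
  apply/seteqP; split=> y; rewrite /xsection /= in_setE /unit_square_part /=.
    by move=> [[? ?] ?].
  by move=> [? [? ?]].
rewrite !sE; have [x01|x01] := pselect (`[0, 1[%classic x); last first.
  by congr (lebesgue_measure _); apply/seteqP; split=> y [].
have := @periodic_affine R B m (c * wave x) m0 mB pB.
set L := lebesgue_measure _; set L' := lebesgue_measure _ => LL.
transitivity L.
  have dE y : descend (@vertical_map R m c) (chart (x, y)) = chart (x, m%:~R * y + c * wave x).
    by rewrite /chart descend_pi; [rewrite /vertical_map !ptE|exact: vertical_equivariant].
  congr (lebesgue_measure _); apply/seteqP; split=> y /=; rewrite /B /= dE.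
    by move=> [_ []].
  by move=> [].
rewrite LL; congr (lebesgue_measure _).
by apply/seteqP; split=> y /=; [move=> []|move=> [_ []]].
Qed.

Lemma horizontal_haar (R : realType) (m : int) (c : R) (A : set (torus R)) :
  m != 0 -> borel A -> haar (descend (@horizontal_map R m c) @^-1` A) = haar A.
Proof.
move=> m0 bA.
have bA' : borel (descend (@horizontal_map R m c) @^-1` A).
  apply: borel_continuous_preimage bA; apply: descend_continuous.
    exact: horizontal_equivariant.
  exact/trig_map_continuous/horizontal_trig.
rewrite (haar_swap bA) (haar_swap bA').
apply: eq_integral => y _ /=.
pose B := [set x : R | A (chart (x, y))].
have mB : measurable B := (borel_sections y bA).2.
have pB : periodic1 B.
  move=> x n hn; rewrite /B /=; congr A; rewrite /chart /=.
  have -> : pt (x + n) y = pt x y + pt n 0 by apply: row2P; rewrite !mxE /= ?addr0.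
  by apply: torus_piD; apply: int_rV_pt => //; exact: rpred0.
have sE (D : set (torus R)) : ysection (unit_square_part D) y =
    [set x | `[0, 1[%classic y /\ `[0, 1[%classic x /\ D (chart (x, y))].
  apply/seteqP; split=> x; rewrite /ysection /= in_setE /unit_square_part /=.
    by move=> [[? ?] ?].
  by move=> [? [? ?]].
rewrite !sE; have [y01|y01] := pselect (`[0, 1[%classic y); last first.
  by congr (lebesgue_measure _); apply/seteqP; split=> x [].
have := @periodic_affine R B m (c * wave y) m0 mB pB.
set L := lebesgue_measure _; set L' := lebesgue_measure _ => LL.
transitivity L.
  have dE x : descend (@horizontal_map R m c) (chart (x, y)) = chart (m%:~R * x + c * wave y, y).
    by rewrite /chart descend_pi; [rewrite /horizontal_map !ptE|exact: horizontal_equivariant].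
  congr (lebesgue_measure _); apply/seteqP; split=> x /=; rewrite /B /= dE.
    by move=> [_ []].
  by move=> [].
rewrite LL; congr (lebesgue_measure _).
by apply/seteqP; split=> x /=; [move=> []|move=> [_ []]].
Qed.

(** The multiplication by k is split between the two coordinates so that each
    factor is well defined on the torus: the shear w (y / k) is not. *)
Lemma lift_map_decomposition (R : realType) (k : int) (a b : R) (z : 'rV[R]_2) :
  lift_map k%:~R a b z =
  vertical_map k 0 (horizontal_map k (- (k%:~R * a)) (vertical_map 1 (- b) z)).
Proof.
rewrite /vertical_map /horizontal_map /lift_map !ptE.
have -> : 1%:~R * z 0 1 + - b * wave (z 0 0) = z 0 1 - b * wave (z 0 0) by ring.
by congr pt; ring.
Qed.

Lemma comp_equivariant (R : realType) (F G : 'rV[R]_2 -> 'rV[R]_2) :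
  Z2_equivariant F -> Z2_equivariant G -> Z2_equivariant (fun z => F (G z)).
Proof.
move=> eF eG z n hn; have := eF (G z) _ (eG z n hn).
by rewrite subrKC.
Qed.

Lemma lift_map_equivariant (R : realType) (k : int) (a b : R) :
  Z2_equivariant (@lift_map R k%:~R a b).
Proof.
move=> z n hn; rewrite !lift_map_decomposition.
exact: (comp_equivariant (@vertical_equivariant R k 0)
  (comp_equivariant (@horizontal_equivariant R k (- (k%:~R * a)))
    (@vertical_equivariant R 1 (- b)))).
Qed.

Definition shear_endo (R : realType) (k : int) (a b : R) :=
  descend (@lift_map R k%:~R a b).

Lemma shear_endo_decomposition (R : realType) (k : int) (a b : R) p :
  shear_endo k a b p = descend (@vertical_map R k 0)
    (descend (@horizontal_map R k (- (k%:~R * a))) (descend (@vertical_map R 1 (- b)) p)).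
Proof.
have [z <-] := torus_pi_surj p.
rewrite (descend_pi _ (@vertical_equivariant R 1 (- b))).
rewrite (descend_pi _ (@horizontal_equivariant R k (- (k%:~R * a)))).
rewrite (descend_pi _ (@vertical_equivariant R k 0)) -lift_map_decomposition.
exact: descend_pi (lift_map_equivariant k a b).
Qed.

Lemma shear_endo_haar (R : realType) (k : int) (a b : R) :
  k != 0 -> preserves_haar (@shear_endo R k a b).
Proof.
move=> k0 A bA.
have cV m c : continuous (descend (@vertical_map R m c)).
  apply: descend_continuous; first exact: vertical_equivariant.
  exact/trig_map_continuous/vertical_trig.
have cH m c : continuous (descend (@horizontal_map R m c)).
  apply: descend_continuous; first exact: horizontal_equivariant.
  exact/trig_map_continuous/horizontal_trig.
pose B := descend (@vertical_map R k 0) @^-1` A.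
have bB : borel B by exact: borel_continuous_preimage (cV k 0) bA.
pose C := descend (@horizontal_map R k (- (k%:~R * a))) @^-1` B.
have bC : borel C by exact: borel_continuous_preimage (cH k _) bB.
have -> : shear_endo k a b @^-1` A = descend (@vertical_map R 1 (- b)) @^-1` C.
  by apply/funext => p; rewrite /C /B /preimage /= shear_endo_decomposition.
have one_neq0 : (1 : int) != 0 by [].
apply: (etrans (vertical_haar (- b) one_neq0 bC)).
apply: (etrans (horizontal_haar (- (k%:~R * a)) k0 bB)).
exact: (@vertical_haar R k 0 A k0 bA).
Qed.

(** * Fibres of the map *)

(** The lift of the composition g of the two shears. *)
Definition unshear (R : realType) (a b : R) (p : 'rV[R]_2) : 'rV[R]_2 :=
  let x := p 0 0 + a * wave (p 0 1) in pt x (p 0 1 + b * wave x).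

Lemma lift_map_unshear (R : realType) (k a b : R) p :
  lift_map k a b (unshear a b p) = k *: p.
Proof.
apply: row2P; rewrite /lift_map /unshear !ptE !mxE; last by rewrite addrK.
by rewrite addrK addrK.
Qed.

Lemma unshear_lift_map (R : realType) (k a b : R) z :
  k != 0 -> unshear a b (k^-1 *: lift_map k a b z) = z.
Proof.
move=> k0; rewrite /unshear /lift_map !mxE /= !mulKf // subrK.
by apply: row2P; rewrite ptE // subrK.
Qed.

Lemma unshear_shift (R : realType) (a b : R) p n : int_rV n ->
  unshear a b (p + n) = unshear a b p + n.
Proof.
move=> hn; have h0 := hn 0; have h1 := hn 1.
have E : p 0 0 + n 0 0 + a * wave (p 0 1 + n 0 1) =
    p 0 0 + a * wave (p 0 1) + n 0 0 by rewrite wave_int //; ring.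
apply: row2P; rewrite /unshear !mxE /= E // (wave_int _ h0); ring.
Qed.

Lemma trigN (R : realType) (f : 'rV[R]_2 -> R) :
  trig_fun f -> trig_fun (fun z => - f z).
Proof.
move=> tf; have -> : (fun z => - f z) = (fun z => -1 * f z).
  by apply/funext => z; rewrite mulN1r.
by apply: trigM => //; exact: trig_cst.
Qed.

Lemma trigZ (R : realType) (c : R) (f : 'rV[R]_2 -> R) :
  trig_fun f -> trig_fun (fun z => c * f z).
Proof. by move=> tf; apply: trigM => //; exact: trig_cst. Qed.

Lemma lift_map_trig (R : realType) (k a b : R) : trig_map (lift_map k a b).
Proof.
have tY : trig_fun (fun z : 'rV[R]_2 => z 0 1 - b * wave (z 0 0)).
  apply: trigD; first exact: trig_coord.
  by apply: trigN; apply: trigZ; apply: trig_fun_wave; exact: trig_coord.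
apply: trig_map_pt; last exact: trigZ.
apply: trigZ; apply: trigD; first exact: trig_coord.
by apply: trigN; apply: trigZ; exact: trig_fun_wave.
Qed.

Lemma unshear_trig (R : realType) (c a b : R) :
  trig_map (fun w => unshear a b (c *: w)).
Proof.
have tC i : trig_fun (fun w : 'rV[R]_2 => (c *: w) 0 i).
  have -> : (fun w : 'rV[R]_2 => (c *: w) 0 i) = (fun w => c * w 0 i).
    by apply/funext => w; rewrite mxE.
  by apply: trigZ; exact: trig_coord.
have tX : trig_fun (fun w : 'rV[R]_2 => (c *: w) 0 0 + a * wave ((c *: w) 0 1)).
  by apply: trigD => //; apply: trigZ; exact: trig_fun_wave.
apply: trig_map_pt => //; apply: trigD => //.
by apply: trigZ; exact: trig_fun_wave.
Qed.

Lemma shear_endo_local_diffeo (R : realType) (r : \bar R) (k : int) (a b : R) :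
  k != 0 -> Cr_local_diffeo r (shear_endo k a b).
Proof.
move=> k0; have k0' : k%:~R != 0 :> R by rewrite intr_eq0.
apply: (descend_local_diffeo r (lift_map_equivariant k a b)
  (lift_map_trig _ _ _) (unshear_trig k%:~R^-1 a b)).
- by move=> z; exact: unshear_lift_map.
- by move=> w; rewrite lift_map_unshear scalerA mulfV // scale1r.
Qed.

(** The grid is taken with steps 1 / |k| rather than 1 / k, so that the sign of
    k does not enter the counting. *)
Definition fibre_lift (R : realType) (k : int) (a b : R) (u : 'rV[R]_2)
    (e : 'I_`|k| * 'I_`|k|) : 'rV[R]_2 :=
  unshear a b (k%:~R^-1 *: u + pt (e.1%:R / `|k|%:R) (e.2%:R / `|k|%:R)).

Lemma unshear_inj (R : realType) (a b : R) : injective (unshear a b).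
Proof.
by move=> p q /(congr1 (lift_map 1 a b)); rewrite !lift_map_unshear !scale1r.
Qed.

(** The remainder of m modulo |k| selects a point of the grid; the integer
    quotient is a translation that the torus does not see. *)
Lemma euclid_grid (R : realType) (k : int) (m : R) : k != 0 -> m \is a Num.int ->
  exists (d : int) (e : 'I_`|k|), k%:~R^-1 * m = e%:R / `|k|%:R + d%:~R.
Proof.
move=> k0 /intrP[M ->].
have K0 : (0 < `|k|)%N by rewrite absz_gt0.
have K0' : (`|k|%N : int) != 0 by rewrite eqz_nat -lt0n.
pose sM := sgz k * M.
have e0 : 0 <= (sM %% `|k|%N)%Z by exact: modz_ge0.
have eK : (`|(sM %% `|k|%N)%Z| < `|k|)%N.
  by rewrite -ltz_nat gez0_abs // ltz_pmod.
exists (sM %/ `|k|%N)%Z, (Ordinal eK) => /=.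
have kK : k%:~R = (sgz k)%:~R * `|k|%:R :> R.
  by rewrite [in LHS](intEsg k) intrM.
have s2 : (sgz k)%:~R * (sgz k)%:~R = 1 :> R.
  by rewrite -intrM; case: (sgzP k) k0.
have KR : `|k|%:R != 0 :> R by rewrite pnatr_eq0 -lt0n.
have sR : (sgz k)%:~R != 0 :> R by rewrite intr_eq0 sgz_eq0.
have E : (sgz k)%:~R * M%:~R = (sM %/ `|k|%N)%Z%:~R * `|k|%:R +
    `|(sM %% `|k|%N)%Z|%:R :> R.
  have -> : `|(sM %% `|k|%N)%Z|%:R = (sM %% `|k|%N)%Z%:~R :> R.
    by rewrite -[in RHS](gez0_abs e0).
  by rewrite -intrM -/sM [in LHS](divz_eq sM `|k|%N) intrD intrM.
apply: (mulfI sR); apply: (mulIf KR).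
rewrite kK invfM.
have -> : (sgz k)%:~R * ((sgz k)%:~R^-1 / `|k|%:R * M%:~R) * `|k|%:R = M%:~R :> R.
  by field; rewrite sR KR.
have -> : M%:~R = (sgz k)%:~R * ((sgz k)%:~R * M%:~R) :> R by rewrite mulrA s2 mul1r.
by rewrite E; field.
Qed.

Lemma fibre_bijection (R : realType) (k : int) (a b : R) (u : 'rV[R]_2) :
  k != 0 ->
  set_bij setT (shear_endo k a b @^-1` [set torus_pi u])
    (fun e : 'I_`|k| * 'I_`|k| => torus_pi (fibre_lift a b u e)).
Proof.
move=> k0; have k0' : k%:~R != 0 :> R by rewrite intr_eq0.
have K0 : (0 < `|k|)%N by rewrite absz_gt0.
have K0' : 0 < `|k|%:R :> R by rewrite ltr0n.
have KR : `|k|%:R != 0 :> R by rewrite gt_eqF.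
have kK : k%:~R = (sgz k)%:~R * `|k|%:R :> R.
  by rewrite [in LHS](intEsg k) intrM.
have eF := lift_map_equivariant k a b.
split.
- move=> e _ /=; apply: (etrans (descend_pi _ eF)).
  rewrite /fibre_lift lift_map_unshear scalerDr scalerA mulfV // scale1r.
  apply: torus_piD => i; rewrite !mxE.
  have E (n : nat) : k%:~R * (n%:R / `|k|%:R) = (sgz k)%:~R * n%:R :> R.
    by rewrite kK; field.
  by case: ifP => _; rewrite E rpredM ?intr_int ?rpred_nat.
- move=> [i j] [i' j'] _ _ /= /eq_torus_pi h.
  set p := k%:~R^-1 *: u + pt (i%:R / `|k|%:R) (j%:R / `|k|%:R) : 'rV[R]_2.
  set p' := k%:~R^-1 *: u + pt (i'%:R / `|k|%:R) (j'%:R / `|k|%:R) : 'rV[R]_2.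
  have hpp : int_rV (p - p').
    have : unshear a b p = unshear a b p' + (unshear a b p - unshear a b p').
      by rewrite subrKC.
    rewrite -unshear_shift // => /unshear_inj E.
    by rewrite {1}E addrC addKr.
  have same (c c' : 'I_`|k|) :
      (c%:R / `|k|%:R - c'%:R / `|k|%:R : R) \is a Num.int -> c = c'.
    move=> hc; apply/val_inj/eqP; rewrite -(eqr_nat R) -subr_eq0.
    have -> : c%:R - c'%:R = (c%:R / `|k|%:R - c'%:R / `|k|%:R) * `|k|%:R :> R.
      by field.
    rewrite mulf_eq0 (negbTE KR) orbF; apply/negPn/negP => nz.
    have := norm_intr_ge1 hc nz.
    rewrite -mulrBl normrM normfV (gtr0_norm K0') ler_pdivlMr // mul1r leNgt.
    have lc : c%:R < `|k|%:R :> R by rewrite ltr_nat.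
    have lc' : c'%:R < `|k|%:R :> R by rewrite ltr_nat.
    have pc : 0 <= c%:R :> R by [].
    have pc' : 0 <= c'%:R :> R by [].
    by rewrite ltr_norml; case/negP; apply/andP; split; lra.
  congr pair; apply: same.
    have := hpp 0; rewrite !mxE /=; congr (_ \is a _); ring.
  by have := hpp 1; rewrite !mxE /=; congr (_ \is a _); ring.
- move=> p; have [z <-] := torus_pi_surj p => /= hz.
  have /eq_torus_pi hm := etrans (esym (descend_pi z eF)) hz.
  have [d0 [e0 E0]] := euclid_grid k0 (hm 0).
  have [d1 [e1 E1]] := euclid_grid k0 (hm 1).
  exists (e0, e1) => //.
  rewrite -[z in RHS](unshear_lift_map a b z k0').
  have -> : k%:~R^-1 *: lift_map k%:~R a b z =
      (k%:~R^-1 *: u + pt (e0%:R / `|k|%:R) (e1%:R / `|k|%:R)) +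
      pt d0%:~R d1%:~R.
    rewrite -{1}(subrK u (lift_map k%:~R a b z)) scalerDr addrC -addrA.
    congr (_ + _); apply: row2P.
      by move: E0; rewrite !mxE.
    by move: E1; rewrite !mxE.
  rewrite unshear_shift; last by apply: int_rV_pt; exact: intr_int.
  by rewrite torus_piD //; apply: int_rV_pt; exact: intr_int.
Qed.

(** Two points of the fibre over 0 are distinct as soon as |k| >= 2. *)
Lemma shear_endo_not_bijective (R : realType) (k : int) (a b : R) :
  (1 < `|k|)%N -> ~ bijective (@shear_endo R k a b).
Proof.
move=> k1 /bij_inj fI.
have k0 : k != 0 by rewrite -absz_gt0; exact: ltn_trans k1.
have [fi I _] := @fibre_bijection R k a b 0 k0.
pose e0 : 'I_`|k| := Ordinal (ltn_trans (ltnSn 0) k1).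
pose e1 : 'I_`|k| := Ordinal k1.
have : (e0, e0) = (e1, e0).
  apply: I; rewrite ?inE //; apply: fI.
  by rewrite (fi (e0, e0) Logic.I) (fi (e1, e0) Logic.I).
by move=> [].
Qed.

(** * Norms of the plane *)

(** The lower constant is the minimum of N on the unit sphere, which is
    compact. *)
Lemma is_norm_equivalence (R : realType) (N : 'rV[R]_2 -> R) : is_norm N ->
  exists alpha beta : R, [/\ 0 < alpha, 0 < beta &
    forall v, alpha * `|v| <= N v <= beta * `|v| ].
Proof.
move=> [N0 [NZ ND]].
have N00 : N 0 = 0 by rewrite -(scale0r 0) NZ normr0 mul0r.
have NN v : N (- v) = N v by rewrite -scaleN1r NZ normrN1 mul1r.
have Nge0 v : 0 <= N v.
  by have := ND v (- v); rewrite subrr N00 NN; lra.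
pose beta := N (pt 1 0) + N (pt 0 1) + 1.
have beta0 : 0 < beta by rewrite ltr_wpDl // addr_ge0.
have Nbeta v : N v <= beta * `|v|.
  have -> : v = v 0 0 *: pt 1 0 + v 0 1 *: pt 0 1.
    by apply: row2P; rewrite !mxE /=; ring.
  set w := (X in beta * `|X|); apply: (le_trans (ND _ _)); rewrite !NZ.
  have -> : v 0 0 = w 0 0 by rewrite !mxE /=; ring.
  have -> : v 0 1 = w 0 1 by rewrite !mxE /=; ring.
  apply: (@le_trans _ _ (`|w| * N (pt 1 0) + `|w| * N (pt 0 1))).
    by apply: lerD; apply: ler_wpM2r => //; exact: norm_coord_le.
  by rewrite -mulrDr mulrC ler_wpM2r // /beta lerDl.
have Nlip v w : `|N v - N w| <= beta * `|v - w|.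
  have h x y : N x - N y <= beta * `|x - y|.
    by rewrite lerBlDr (le_trans _ (lerD (Nbeta (x - y)) (lexx (N y)))) //
       -{1}(subrK y x) ND.
  by rewrite ler_norml h andbT lerNl opprB distrC h.
have Ncont : forall v : 'rV[R]_2, N @ v --> N v.
  move=> v; apply: (proj2 (@cvgrPdist_lt _ _ _ (nbhs v) _ N (N v))) => e e0.
  near=> w.
  apply: (le_lt_trans (Nlip _ _)); rewrite -ltr_pdivlMl //.
  near: w; apply/nbhs_ballP; exists (beta^-1 * e).
    by rewrite /= mulr_gt0 // invr_gt0.
  by move=> w; rewrite -ball_normE.
pose S := [set v : 'rV[R]_2 | `|v| = 1].
have cS : compact S.
  apply: bounded_closed_compact.
    by exists 1; split => // x x1 v /= ->; exact: ltW.
  have -> : S = (fun v : 'rV[R]_2 => `|v|) @^-1` [set 1] by [].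
  by apply: closed_comp => [v _|]; [exact: norm_continuous|exact: closed_eq].
have S0 : S !=set0.
  by exists (pt 1 0); rewrite /S /= norm_row2 !ptE normr1 normr0 max_l.
have [c cS' cmin] := EVT_min_rV S0 cS (continuous_subspaceT Ncont).
have c1 : `|c| = 1 by rewrite inE in cS'.
exists (N c), beta; split => //.
  rewrite lt_neqAle Nge0 andbT eq_sym; apply/eqP => /N0 cz.
  by move: c1; rewrite cz normr0 => /eqP; rewrite eq_sym oner_eq0.
move=> v; rewrite Nbeta andbT.
have [->|v0] := eqVneq v 0; first by rewrite normr0 mulr0.
have nv : 0 < `|v| by rewrite normr_gt0.
have -> : N v = N (`|v|^-1 *: v) * `|v|.
  by rewrite NZ normfV normr_id mulrAC mulVf ?gt_eqF // mul1r.
rewrite ler_pM2r //; apply: cmin; rewrite inE /S /=.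
by rewrite normrZ normfV normr_id mulVf // gt_eqF.
Unshelve. all: by end_near. Qed.

(** * The tangent map *)

(** Increments rather than values, because two local lifts agree only up to a
    constant. *)
Lemma near_eq_diff (R : realType) (F G : 'rV[R]_2 -> 'rV[R]_2) x :
  (\forall z \near x, F z - F x = G z - G x) -> differentiable G x ->
  'd F x = 'd G x :> ('rV[R]_2 -> 'rV[R]_2).
Proof.
move=> FG dG; apply: diff_unique; first exact: diff_continuous.
apply/eqaddoP => e e0.
have /eqaddoP /(_ e e0) := diff_locally dG.
have FG0 : \forall z \near (0 : 'rV[R]_2), F (z + x) - F x = G (z + x) - G x.
  have sc : {for 0, continuous (fun z : 'rV[R]_2 => z + x)}.
    by apply: continuousD; [exact: id|exact: cst_continuous].
  pose B : set 'rV[R]_2 := [set w | F w - F x = G w - G x].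
  suff : \forall z \near (0 : 'rV[R]_2), B (z + x) by [].
  by apply: sc; rewrite add0r.
by apply: filterS2 FG0 => z hz; rewrite !fctE /= !opprD !addrA hz.
Qed.

(** The difference of two lifts is integer valued near x and continuous at x,
    hence constant near x. So the choice of a lift in the tangent map is
    immaterial. *)
Lemma local_lift_jacobian (R : realType) (f : torus R -> torus R) x
    (F G : 'rV[R]_2 -> 'rV[R]_2) :
  local_lift f x F -> local_lift f x G -> differentiable G x -> 'J F x = 'J G x.
Proof.
move=> [cF hF] [cG hG] dG.
have FG_int : \forall z \near x, int_rV (F z - G z).
  near=> z; apply/eq_torus_pi; transitivity (f (torus_pi z)).
    by near: z.
  by symmetry; near: z.
have c_int := nbhs_singleton FG_int.
pose c := F x - G x.
suff FG : \forall z \near x, F z - F x = G z - G x.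
  exact: (congr1 (@lin1_mx R 2 2) (near_eq_diff FG dG)).
have small : \forall z \near x, `|c - (F z - G z)| < 1.
  have sc : {for x, continuous (fun z => F z - G z)} by exact: continuousB.
  by apply: (proj1 (@cvgrPdist_lt _ _ _ (nbhs x) _ _ _) sc).
near=> z.
have hz : int_rV (F z - G z) by near: z.
have sz : `|c - (F z - G z)| < 1 by near: z.
have hc : int_rV (c - (F z - G z)).
  by move=> i; have := rpredB (c_int i) (hz i); rewrite !mxE.
have /eqP := int_rV_small hc sz; rewrite subr_eq0 => /eqP E.
have -> : F z = c + G z by rewrite E subrK.
by rewrite /c addrAC [F x - G x]addrC addrK addrC.
Unshelve. all: by end_near. Qed.

Lemma cos_int (R : realType) (x n : R) : n \is a Num.int ->
  cos (2 * pi * (x + n)) = cos (2 * pi * x).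
Proof.
move=> hn; rewrite mulrDr [2 * pi]mulr_natl; apply: periodic_intmul => //.
exact: cosD2pi.
Qed.

Lemma is_derive_wave_comp (R : realType) (f : 'rV[R]_2 -> R) z v (df : R) :
  differentiable f z -> is_derive z v f df ->
  is_derive z v (fun w => wave (f w)) (cos (2 * pi * f z) * df).
Proof.
move=> dfz [_ <-]; have [h1 h2] := is_diff_comp1 dfz (is_derive_wave (f z)).
by apply: DeriveDef; [exact: diff_derivable|exact: h2].
Qed.

Lemma is_derive_scale (R : realType) (f : 'rV[R]_2 -> R) (c df : R) z v :
  is_derive z v f df -> is_derive z v (fun w => c * f w) (c * df).
Proof. by move=> h; have := @is_deriveZ R _ _ f c z v df h. Qed.

Lemma is_derive_sub_scale (R : realType) (f g : 'rV[R]_2 -> R) (c df dg : R) z v :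
  is_derive z v f df -> is_derive z v g dg ->
  is_derive z v (fun w => f w - c * g w) (df - c * dg).
Proof.
by move=> hf hg; have := @is_deriveB R _ _ f _ z v df _ hf (is_derive_scale c hg).
Qed.

Lemma derive_lift_map (R : realType) (k a b : R) (z v : 'rV[R]_2) :
  let c := cos (2 * pi * z 0 0) in
  let d := cos (2 * pi * (z 0 1 - b * wave (z 0 0))) in
  let s := v 0 1 - b * (c * v 0 0) in
  'D_v (lift_map k a b) z = pt (k * (v 0 0 - a * (d * s))) (k * s).
Proof.
move=> c d s.
have dX (i : 'I_2) : is_derive z v (fun w : 'rV[R]_2 => w 0 i : R) (v 0 i).
  apply: DeriveDef; last exact: derive_coord.
  by apply: diff_derivable; exact: differentiable_coord.
have tX i : differentiable (fun w : 'rV[R]_2 => w 0 i : R) z.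
  exact: differentiable_coord.
have dS : is_derive z v (fun w : 'rV[R]_2 => w 0 1 - b * wave (w 0 0)) s.
  exact: is_derive_sub_scale (dX 1) (is_derive_wave_comp (tX 0) (dX 0)).
have tS : differentiable (fun w : 'rV[R]_2 => w 0 1 - b * wave (w 0 0)) z.
  apply: trig_fun_differentiable; apply: trigD; first exact: trig_coord.
  by apply: trigN; apply: trigZ; apply: trig_fun_wave; exact: trig_coord.
have d0 : is_derive z v (fun w : 'rV[R]_2 =>
    k * (w 0 0 - a * wave (w 0 1 - b * wave (w 0 0)))) (k * (v 0 0 - a * (d * s))).
  apply: is_derive_scale.
  exact: is_derive_sub_scale (dX 0) (is_derive_wave_comp tS dS).
have d1 : is_derive z v (fun w : 'rV[R]_2 => k * (w 0 1 - b * wave (w 0 0))) (k * s).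
  exact: is_derive_scale dS.
have dF := trig_map_differentiable z (lift_map_trig k a b).
apply: row2P; rewrite derive_rV // ptE.
  have -> : (fun x => lift_map k a b x 0 0) =
      (fun w => k * (w 0 0 - a * wave (w 0 1 - b * wave (w 0 0)))).
    by apply/funext => w; rewrite /lift_map ptE.
  by have [_ ->] := d0.
have -> : (fun x => lift_map k a b x 0 1) =
    (fun w => k * (w 0 1 - b * wave (w 0 0))).
  by apply/funext => w; rewrite /lift_map ptE.
by have [_ ->] := d1.
Qed.

Lemma det_mx2 (R : comNzRingType) (A : 'M[R]_2) :
  \det A = A 0 0 * A 1 1 - A 0 1 * A 1 0.
Proof.
rewrite (expand_det_row _ 0) !big_ord_recl big_ord0 addr0 /cofactor !det_mx11 !mxE.
rewrite /= expr0 expr1 mul1r mulN1r mulrN.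
by congr (_ * A _ _ - A _ _ * A _ _); apply/val_inj.
Qed.

(** The inverse derivative undoes the multiplication by k and then applies the
    derivatives of the two shears in the order of g. *)
Lemma lift_map_jacobian (R : realType) (k a b : R) (z : 'rV[R]_2) : k != 0 ->
  \det ('J (lift_map k a b) z) = k ^+ 2 /\
  forall v : 'rV[R]_2, let c := cos (2 * pi * z 0 0) in
    let d := cos (2 * pi * (z 0 1 - b * wave (z 0 0))) in
    let p := v 0 0 + a * d * v 0 1 in
    v *m invmx ('J (lift_map k a b) z) = k^-1 *: pt p (v 0 1 + b * c * p).
Proof.
move=> k0; set J := 'J _ _.
set c := cos (2 * pi * z 0 0); set d := cos (2 * pi * (z 0 1 - _)).
have dF := trig_map_differentiable z (lift_map_trig k a b).
have JE (v : 'rV[R]_2) : v *m J = pt (k * (v 0 0 - a * (d * (v 0 1 - b * (c * v 0 0)))))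
    (k * (v 0 1 - b * (c * v 0 0))).
  by rewrite -deriveEjacobian // derive_lift_map.
have Jij i j : J i j = ((delta_mx 0 i : 'rV[R]_2) *m J) 0 j.
  by rewrite -(rowE i J) [RHS]mxE.
have detJ : \det J = k ^+ 2.
  by rewrite det_mx2 !Jij !JE !ptE !mxE /=; ring.
have Ju : J \in unitmx by rewrite unitmxE detJ unitfE expf_neq0.
split=> // v; rewrite -/c -/d /=.
set w := (X in _ = X).
have <- : w *m J = v by rewrite JE; apply: row2P; rewrite /w !mxE /=; field.
by rewrite mulmxK.
Qed.

Lemma tangent_map_shear_endo (R : realType) (k : int) (a b : R) (y : torus R) :
  tangent_map (shear_endo k a b) y = 'J (lift_map k%:~R a b) (repr y).
Proof.
have dF := trig_map_differentiable (repr y) (lift_map_trig k%:~R a b).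
have lF : local_lift (shear_endo k a b) (repr y) (lift_map k%:~R a b).
  apply: local_lift_descend; first exact: lift_map_equivariant.
  exact: differentiable_continuous.
apply: (local_lift_jacobian _ lF dF).
exact: (@getPex _ [set F | local_lift (shear_endo k a b) (repr y) F]
  (ex_intro _ _ lF)).
Qed.

(** The tangent map is computed at an arbitrary representative, which differs
    from the point of the fibre by an integer vector; cosines and shears are
    insensitive to it. *)
Lemma tangent_map_fibre (R : realType) (k : int) (a b : R) (u v : 'rV[R]_2)
    (e : 'I_`|k| * 'I_`|k|) : k != 0 ->
  let T := tangent_map (shear_endo k a b) (torus_pi (fibre_lift a b u e)) in
  let K : R := `|k|%:R in
  let Y := k%:~R^-1 * u 0 1 + e.2%:R / K in
  let X := k%:~R^-1 * u 0 0 + e.1%:R / K + a * wave Y in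
  let p := v 0 0 + a * cos (2 * pi * Y) * v 0 1 in
  \det T = k%:~R ^+ 2 /\
  v *m invmx T = k%:~R^-1 *: pt p (v 0 1 + b * cos (2 * pi * X) * p).
Proof.
move=> k0 T K Y X p; have k0' : k%:~R != 0 :> R by rewrite intr_eq0.
rewrite /T tangent_map_shear_endo; set z := repr _.
have [h1 h2] := lift_map_jacobian a b z k0'; split=> //; rewrite h2 /=.
have zi : int_rV (z - fibre_lift a b u e).
  by apply/eq_torus_pi; rewrite /torus_pi reprK.
have i0 := zi 0; have i1 := zi 1.
have E0 : z 0 0 = X + (z - fibre_lift a b u e) 0 0.
  by rewrite !mxE /= /X /Y; ring.
have E1 : z 0 1 = Y + b * wave X + (z - fibre_lift a b u e) 0 1.
  by rewrite !mxE /= /X /Y; ring.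
rewrite E0 (cos_int _ i0) (wave_int _ i0) E1.
have -> : Y + b * wave X + (z - fibre_lift a b u e) 0 1 - b * wave X =
  Y + (z - fibre_lift a b u e) 0 1 by ring.
by rewrite (cos_int _ i1).
Qed.

(** * The lower bound for the expansion *)

Lemma fsbig_finType (R : realType) (I : finType) (F : I -> R) :
  \sum_(i \in [set: I]) F i = \sum_i F i.
Proof.
have -> : [set: I] = [set` index_enum I].
  by apply/seteqP; split=> i //= _; rewrite mem_index_enum.
by rewrite -fsbig_seq // index_enum_uniq.
Qed.

Lemma sqr_absz (R : realType) (k : int) : k%:~R ^+ 2 = `|k|%:R ^+ 2 :> R.
Proof. by case: k => n //; rewrite NegzE rmorphN sqrrN. Qed.

Lemma I_sum_shear_endo (R : realType) (N : 'rV[R]_2 -> R) (k : int) (b : R)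
    (u v : 'rV[R]_2) : k != 0 ->
  let K : R := `|k|%:R in
  let Y (j : 'I_`|k|) := k%:~R^-1 * u 0 1 + j%:R / K in
  let X (j : 'I_`|k|) := k%:~R^-1 * u 0 0 + wave (Y j) in
  let p (j : 'I_`|k|) := v 0 0 + cos (2 * pi * Y j) * v 0 1 in
  let q (j i : 'I_`|k|) := v 0 1 + b * cos (2 * pi * (X j + i%:R / K)) * p j in
  I_sum N (shear_endo k 1 b) 1 (torus_pi u) v =
  (\sum_(j < `|k|) \sum_(i < `|k|) ln (N (k%:~R^-1 *: pt (p j) (q j i)))) / K ^+ 2.
Proof.
move=> k0 K Y X p q.
rewrite /I_sum (reindex_fsbig _ _ _ _ (fibre_bijection 1 b u k0)) fsbig_finType.
rewrite exchange_big pair_bigA mulr_suml; apply: eq_bigr => e _.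
have [h1 h2] := tangent_map_fibre 1 b u v e k0.
rewrite /= in h1 h2; rewrite h1 h2 sqr_absz !mul1r.
have E : X e.2 + e.1%:R / K =
    k%:~R^-1 * u 0 0 + e.1%:R / `|k|%:R + wave (k%:~R^-1 * u 0 1 + e.2%:R / `|k|%:R).
  by rewrite /X addrAC.
by rewrite /= /q E.
Qed.

(** The value b = exp S is chosen so that log b pays for K^2 times all the
    constants, and leaves K^2. *)
Lemma I_sum_large (R : realType) (N : 'rV[R]_2 -> R) (k : int) :
  is_norm N -> (5 <= `|k|)%N ->
  exists b : R, forall x v, N v = 1 -> 1 <= I_sum N (shear_endo k 1 b) 1 x v.
Proof.
move=> hN k5; have k0 : k != 0 by rewrite -absz_gt0; apply: leq_trans k5.
have K0 : 0 < `|k|%:R :> R by rewrite ltr0n absz_gt0.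
have [al [be [al0 be0 Nab]]] := is_norm_equivalence hN.
have [c c0 hc] := @grid_log_average R _ k5.
set K : R := `|k|%:R in K0 hc.
pose M := ln (al / K) + ln (c / be).
pose S := K ^+ 2 * (1 + `|M|).
have S0 : 0 <= S by rewrite mulr_ge0 ?exprn_ge0 ?addr_ge0 // ltW.
exists (expR S) => x v Nv; have [u <-] := torus_pi_surj x.
pose Y (j : 'I_`|k|) := k%:~R^-1 * u 0 1 + j%:R / K.
pose X (j : 'I_`|k|) := k%:~R^-1 * u 0 0 + wave (Y j).
pose p (j : 'I_`|k|) := v 0 0 + cos (2 * pi * Y j) * v 0 1.
pose q (j i : 'I_`|k|) :=
  v 0 1 + expR S * cos (2 * pi * (X j + i%:R / K)) * p j.
rewrite (I_sum_shear_endo N (expR S) u v k0).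
change (1 <= (\sum_(j < `|k|) \sum_(i < `|k|)
  ln (N (k%:~R^-1 *: pt (p j) (q j i)))) / K ^+ 2).
have v1 : be^-1 <= `|v|.
  have /andP[_] := Nab v; rewrite Nv => h.
  by rewrite -[be^-1]mulr1 ler_pdivrMl.
have m0 : 0 < Num.max `|v 0 0| `|v 0 1|.
  by rewrite -norm_row2; apply: lt_le_trans v1; rewrite invr_gt0.
have t1 : 1 <= expR S by rewrite -expR0 ler_expR.
have := hc (expR S) (v 0 0) (v 0 1) (k%:~R^-1 * u 0 1) X t1 m0.
rewrite -norm_row2 expRK => avg.
rewrite ler_pdivlMr ?exprn_gt0 // mul1r.
have pos j i : 0 < Num.max `|p j| `|q j i|.
  rewrite lt_max !normr_gt0; apply/negPn/negP; rewrite negb_or !negbK.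
  move=> /andP[/eqP pj /eqP]; rewrite /q pj mulr0 addr0 => v10.
  move: pj m0; rewrite /p v10 mulr0 addr0 => ->.
  by rewrite maxxx normr0 ltxx.
apply: (@le_trans _ _ (\sum_(j < `|k|) \sum_(i < `|k|)
   (ln (al / K) + ln (Num.max `|p j| `|q j i|)))); last first.
  apply: ler_sum => j _; apply: ler_sum => i _.
  have /andP[h _] := Nab (k%:~R^-1 *: pt (p j) (q j i)).
  have w_norm : al * `|k%:~R^-1 *: pt (p j) (q j i)| =
      al / K * Num.max `|p j| `|q j i|.
    rewrite normrZ norm_row2 !ptE normfV -mulrA; congr (_ * (_^-1 * _)).
    by rewrite -intr_norm -natr_absz.
  rewrite w_norm in h.
  have pos' : 0 < al / K * Num.max `|p j| `|q j i|.
    by rewrite mulr_gt0 ?divr_gt0.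
  rewrite -lnM ?posrE ?divr_gt0 // ler_ln ?posrE //.
  exact: lt_le_trans h.
under eq_bigr do rewrite big_split /= sumr_const card_ord -mulr_natl -/K.
rewrite big_split /= sumr_const card_ord -[_ *+ `|k|]mulr_natl -/K mulrA -expr2.
apply: le_trans (lerD (lexx _) avg).
have lc : ln (c / be) <= ln (c * `|v|).
  rewrite ler_ln ?posrE ?divr_gt0 ?mulr_gt0 ?ler_pM2l //.
  by rewrite (lt_le_trans _ v1) // invr_gt0.
have : K ^+ 2 * (ln (al / K) + ln (c / be)) <=
    K ^+ 2 * (ln (al / K) + ln (c * `|v|)).
  by rewrite ler_pM2l ?exprn_gt0 // lerD2l.
rewrite -/M /S.
have : 0 <= K ^+ 2 * (`|M| + M).
  apply: mulr_ge0; first exact: exprn_ge0 (ltW K0).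
  by have := ler_norm (- M); rewrite normrN; lra.
rewrite !mulrDr; lra.
Qed.

(** * The homotopy *)

Lemma wave_continuous (R : realType) : continuous (@wave R).
Proof.
move=> x; apply/differentiable_continuous/derivable1_diffP.
by have [] := is_derive_wave x.
Qed.

Lemma lift_map_continuous (R : realType) (k b : R) :
  continuous (fun q : R * 'rV[R]_2 => lift_map k q.1 (q.1 * b) q.2).
Proof.
move=> q.
have cX (i : 'I_2) : {for q, continuous (fun q : R * 'rV[R]_2 => q.2 0 i : R)}.
  apply: (@continuous_comp _ _ _ snd (fun z : 'rV[R]_2 => z 0 i)).
    exact: cvg_snd.
  exact: coord_continuous.
have c1 : {for q, continuous (fun q : R * 'rV[R]_2 => q.1)} by exact: cvg_fst.
have cW (f : R * 'rV[R]_2 -> R) : {for q, continuous f} ->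
    {for q, continuous (fun q => wave (f q))}.
  by move=> cf; apply: continuous_comp => //; exact: wave_continuous.
have cc (c : R) : {for q, continuous (fun _ : R * 'rV[R]_2 => c)}.
  exact: cst_continuous.
have cY : {for q, continuous
    (fun q : R * 'rV[R]_2 => q.2 0 1 - q.1 * b * wave (q.2 0 0))}.
  apply: continuousB => //; apply: continuousM; last exact: cW.
  exact: continuousM.
have c0 : {for q, continuous (fun q : R * 'rV[R]_2 =>
    k * (q.2 0 0 - q.1 * wave (q.2 0 1 - q.1 * b * wave (q.2 0 0))))}.
  apply: continuousM => //; apply: continuousB => //; apply: continuousM => //.
  exact: cW.
have c01 : {for q, continuous (fun q : R * 'rV[R]_2 =>
    k * (q.2 0 1 - q.1 * b * wave (q.2 0 0)))} by exact: continuousM.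
have -> : (fun q : R * 'rV[R]_2 => lift_map k q.1 (q.1 * b) q.2) =
  (fun q => (k * (q.2 0 0 - q.1 * wave (q.2 0 1 - q.1 * b * wave (q.2 0 0))))
      *: pt 1 0 + (k * (q.2 0 1 - q.1 * b * wave (q.2 0 0))) *: pt 0 1).
  by apply/funext => w; apply: row2P; rewrite /lift_map !mxE /=; ring.
apply: cvgD; [exact: (cvgZ c0 (cvg_cst _))|exact: (cvgZ c01 (cvg_cst _))].
Qed.

(** Both shears are scaled by t. Joint continuity passes to the quotient
    because the projection onto the torus is open. *)
Lemma shear_endo_homotopy (R : realType) (k : int) (b : R) :
  is_homotopy (fun t => @shear_endo R k t (t * b)) (toral_endo k%:M)
    (shear_endo k 1 b).
Proof.
split; last split.
- apply: continuous_subspaceT => -[t p].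
  have [z <-] := torus_pi_surj p => A /= hA.
  have cPhi : {for (t, z), continuous
      (fun q : R * 'rV[R]_2 => torus_pi (lift_map k%:~R q.1 (q.1 * b) q.2))}.
    apply: continuous_comp; first exact: lift_map_continuous.
    exact: torus_pi_continuous.
  have := cPhi A; rewrite /= -(descend_pi z (lift_map_equivariant k t (t * b))).
  move=> /(_ hA) [[B C] /= [hB hC] BC].
  exists (B, @torus_pi R @` C^°).
    split => //=; apply: (@open_nbhs_nbhs (torus R)); split.
      by apply: torus_pi_open; exact: open_interior.
    by exists z.
  move=> [t' _] /= [Bt' [z' Cz' <-]]; rewrite /preimage /=.
  rewrite /shear_endo (descend_pi z' (lift_map_equivariant k t' (t' * b))).
  by apply: (BC (t', z')); split => //=; exact: interior_subset Cz'.
- apply/funext => p; have [z <-] := torus_pi_surj p.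
  rewrite mul0r toral_endo_pi.
  apply: (etrans (descend_pi z (lift_map_equivariant k 0 0))).
  congr torus_pi; have -> : map_mx intr k%:M = (k%:~R)%:M :> 'M[R]_2.
    by rewrite map_scalar_mx.
  by rewrite tr_scalar_mx mul_mx_scalar; apply: row2P;
    rewrite /lift_map !mxE /= !mul0r !subr0.
- by rewrite mul1r.
Qed.

Lemma shear_endo_analytic (R : realType) (k : int) (a b : R) :
  torus_analytic (shear_endo k a b).
Proof.
move=> z; exists (lift_map k%:~R a b); split; last exact: lift_map_analytic.
apply: local_lift_descend; first exact: lift_map_equivariant.
exact/trig_map_continuous/lift_map_trig.
Qed.

Theorem theorem1 (R : realType) (r : \bar R) (N : 'rV[R]_2 -> R) (k : int)
    (hr : (1 <= r)%E) (hN : is_norm N) (hk : 5 <= `|k|) :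
  let E := @toral_endo R (k%:M) in
  homotopy_class E `&` calU r N !=set0 /\
  exists f, (homotopy_class E `&` calU r N) f /\ analytically_homotopic E f.
Proof.
move=> E.
suff [f [fU fA]] : exists f, (homotopy_class E `&` calU r N) f /\
    analytically_homotopic E f by split; [exists f|exists f].
have k5 : (5 <= `|k|)%N by rewrite -lez_nat.
have k0 : k != 0 by rewrite -absz_gt0; apply: leq_trans k5.
have [b hb] := I_sum_large hN k5.
exists (shear_endo k 1 b).
have hH := shear_endo_homotopy k b.
split; last first.
  by exists (fun t => shear_endo k t (t * b)); split => // t _ _; exact: shear_endo_analytic.
split; first by exists (fun t => shear_endo k t (t * b)).
split.
  split; first exact: shear_endo_local_diffeo.
  split; first exact: shear_endo_haar.
  by apply: shear_endo_not_bijective; apply: leq_trans k5.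
apply: (@lt_le_trans _ _ 1%E) => //.
apply: ereal_sup_ge; eexists; first by exists 1.
rewrite invr1 mul1e; apply: le_ereal_inf_tmp => _ [[x v] /= Nv <-].
by rewrite lee_fin; exact: hb.
Qed.
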